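(* Let $k_n,\dots,k_1\in\{+,-\}$, let $k$ be the number of $i$ with $k_i=-$, and let $D_1=d(k_n,\dots,k_1)$ and $\operatorname{flip}(D_1)=d(k_1,\dots,k_n)$ (the diagram associated with the reversed label). The canonical basis element $v_{k_n}\diamondsuit\cdots\diamondsuit v_{k_1}$ is the unique element $w\in V^{\otimes n}$ such that, for every $0\le k'\le n$ and every $n$-diagram $D_2$ in the diagrammatic basis of $\operatorname{Ind}_{\mathrm{TL}_{k'}\otimes\mathrm{TL}_{n-k'}}^{\mathrm{TL}_n}\mathbb K_{\mathrm{triv}}$, $$\big\langle \underbrace{v_-\otimes\cdots\otimes v_-}_{k'}\otimes\underbrace{v_+\otimes\cdots\otimes v_+}_{n-k'},\ \zeta^*(D_2)\,w\big\rangle=\begin{cases}1&\text{if }k'=k\text{ and }D_2=\operatorname{flip}(D_1),\\0&\text{otherwise.}\end{cases}$$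
   Context: Let $q$ be an indeterminate, $\mathbb K=\mathbb C(q)$, and let $a\mapsto\bar a$ be the $\mathbb C$-linear field automorphism of $\mathbb K$ with $\bar q=q^{-1}$. $V=\mathbb K v_+\oplus\mathbb K v_-$. Diagrams. An $n$-diagram consists of two parallel horizontal lines (bottom and top) with $n$ vertices each, numbered from left to right, the $2n$ vertices being joined in pairs by pairwise non-crossing edges (''links'') drawn between the lines, up to homotopy. $\mathrm{TL}_n$ is the $\mathbb K$-algebra with basis the $n$-diagrams; the product $D'D$ is obtained by stacking $D'$ on top of $D$ and replacing each closed loop by $-q-q^{-1}$. It is generated by $e_1,\dots,e_{n-1}$, where $e_i$ joins vertices $i,i+1$ on the bottom line and on the top line and has vertical links elsewhere. $\mathrm{TL}_{k}\otimes\mathrm{TL}_{n-k}\subseteq\mathrm{TL}_n$ is generated by the $e_i$ with $i\ne k$, which act by $0$ on $\mathbb K_{\mathrm{triv}}$; the diagrammatic basis of $\operatorname{Ind}_{\mathrm{TL}_{k}\otimes\mathrm{TL}_{n-k}}^{\mathrm{TL}_n}\mathbb K_{\mathrm{triv}}$ is given by the $n$-diagrams having no link joining two of the first $k$ bottom vertices and no link joining two of the last $n-k$ bottom vertices. Diagram of a label. For $k_n,\dots,k_1\in\{+,-\}$ with exactly $k$ signs $-$, the diagram $d(k_n,\dots,k_1)$ is built as follows. Label the top vertices from left to right by $v_{k_n},\dots,v_{k_1}$. Process the indices $i$ with $k_i=+$ in increasing order of $i$: if there is a not yet linked $v_{k_j}$ with $j<i$ and $k_j=-$, take the greatest such $j$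 and link $v_{k_i}$ with $v_{k_j}$; otherwise do nothing. Let $p$ be the number of links so drawn. On the bottom line link vertex $k-i$ with vertex $k+1+i$ for $0\le i\le p-1$. Finally link the $i$th unlinked bottom vertex from the left with the $i$th unlinked top vertex from the left, for $1\le i\le n-2p$. Right action. $\zeta^*:\mathrm{TL}_n\to\operatorname{End}(V^{\otimes n})$ is the anti-homomorphism of algebras (right action) such that $\zeta^*(e_i)$ acts on the $(n-i)$th and $(n-i+1)$th tensor components from the left by the matrix $$\begin{pmatrix}0&0&0&0\\0&-q^{-1}&1&0\\0&1&-q&0\\0&0&0&0\end{pmatrix}$$ in the ordered basis $v_+\otimes v_+,\ v_+\otimes v_-,\ v_-\otimes v_+,\ v_-\otimes v_-$ of $V\otimes V$, and by the identity on the other components. Pairing. The bilinear pairing on $V^{\otimes n}$ is $\langle v_{k_n}\otimes v_{k_{n-1}}\otimes\cdots\otimes v_{k_1},\ v_{k_1'}\otimes\cdots\otimes v_{k_{n-1}'}\otimes v_{k_n'}\rangle=\delta_{k_1,k_1'}\cdots\delta_{k_n,k_n'}$. Canonical basis. Let $K,E,F$ act on $V$ by $K v_\pm=q^{\pm1}v_\pm$, $Ev_+=0$, $Ev_-=v_+$, $Fv_+=v_-$, $Fv_-=0$, and let $F$ act on $V^{\otimes m}$ by $\sum_{j=1}^m 1^{\otimes(j-1)}\otimes F\otimes (K^{-1})^{\otimes(m-j)}$. Let $\theta_m$ be the antilinear involution of $V^{\otimes m}$ determined by $\theta_1(v_\pm)=v_\pm$ and $\theta_m(x\otimes v)=\theta_{m-1}(x)\otimes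 v-(q-q^{-1})\,F\theta_{m-1}(x)\otimes Ev$ for $x\in V^{\otimes(m-1)}$, $v\in\{v_+,v_-\}$. The canonical basis element $v_{k_n}\diamondsuit\cdots\diamondsuit v_{k_1}$ is the unique $\theta_n$-fixed element such that $v_{k_n}\diamondsuit\cdots\diamondsuit v_{k_1}-v_{k_n}\otimes\cdots\otimes v_{k_1}$ is a $q^{-1}\mathbb Z[q^{-1}]$-linear combination of vectors $v_{l_n}\otimes\cdots\otimes v_{l_1}$ with $\sum_{i=1}^n l_i=\sum_{i=1}^n k_i$ and $\sum_{i=1}^{n'}l_i\ge\sum_{i=1}^{n'}k_i$ for $1\le n'\le n$ (reading $\pm$ as $\pm1$). *)

(* Defs.v *)
From HB Require Import structures.
From mathcomp Require Import all_boot all_order all_algebra.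
From mathcomp Require Import generic_quotient fraction.
From mathcomp Require Import reals complex.
From mathcomp Require Import zify.

Set Implicit Arguments.
Unset Strict Implicit.
Unset Printing Implicit Defensive.
Import Order.TTheory GRing.Theory Num.Theory.
Local Open Scope ring_scope.

Local Notation "x %:F" := (@FracField.tofrac _ x).

Section GroundField.
Variable R : realType.

(* A realType is the field of real numbers, so R[i] is the field of complex
   numbers and Kq is C(q). *)
Definition Kq : fieldType := {fraction {poly R[i]}}.

Definition q : Kq := ('X : {poly R[i]})%:F.

Definition scal (c : R[i]) : Kq := (c%:P)%:F.

Fact scal_is_zmod_morphism : zmod_morphism scal.
Proof. by move=> x y; rewrite /scal !rmorphB. Qed.

Fact scal_is_monoid_morphism : monoid_morphism scal.
Proof. by split=> [|x y]; rewrite /scal ?rmorph1 ?rmorphM. Qed.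

HB.instance Definition _ :=
  GRing.isZmodMorphism.Build R[i] Kq scal scal_is_zmod_morphism.
HB.instance Definition _ :=
  GRing.isMonoidMorphism.Build R[i] Kq scal scal_is_monoid_morphism.

Definition eval_qV (p : {poly R[i]}) : Kq := (map_poly scal p).[q^-1].

Definition bar (x : Kq) : Kq :=
  eval_qV \n_(repr x) / eval_qV \d_(repr x).

Lemma q_neq0 : q != 0.
Proof. by rewrite /q tofrac_eq0 polyX_eq0. Qed.

Lemma eval_qV_is_zmod_morphism : zmod_morphism eval_qV.
Proof. by move=> x y; rewrite /eval_qV rmorphB /= !hornerE. Qed.

Lemma eval_qV_is_monoid_morphism : monoid_morphism eval_qV.
Proof.
by split=> [|x y]; rewrite /eval_qV ?rmorph1 ?rmorphM /= ?hornerE.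
Qed.

HB.instance Definition _ :=
  GRing.isZmodMorphism.Build {poly R[i]} Kq eval_qV eval_qV_is_zmod_morphism.
HB.instance Definition _ :=
  GRing.isMonoidMorphism.Build {poly R[i]} Kq eval_qV
    eval_qV_is_monoid_morphism.

Lemma eval_qV_eq0 p : (eval_qV p == 0) = (p == 0).
Proof.
apply/idP/idP => [/eqP p0|/eqP ->]; last by rewrite rmorph0.
set m := size p.
have: (\poly_(i < m) p`_(m.-1 - i))%:F = q ^+ m.-1 * eval_qV p :> Kq.
  rewrite /eval_qV (@horner_coef_wide _ m); last by rewrite size_map_poly.
  rewrite poly_def rmorph_sum mulr_sumr (reindex_inj rev_ord_inj) /=.
  apply: eq_bigr => i _; rewrite coef_map /= -mul_polyC rmorphM rmorphXn /=.
  rewrite -/(scal _) -/q mulrCA; congr (scal p`_ _ * _).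
    by have := ltn_ord i; rewrite -/m; lia.
  have -> : (m - i.+1 = m.-1 - i)%N by lia.
  rewrite exprVn -exprB ?unitfE ?q_neq0 //.
  by have := ltn_ord i; rewrite -/m; lia.
rewrite p0 mulr0 => /eqP; rewrite tofrac_eq0 => /eqP/polyP h.
apply/eqP/polyP => i; rewrite coef0; have [im|im] := ltnP i m; last first.
  by rewrite nth_default.
have := h (m.-1 - i)%N; rewrite coef0 coef_poly.
have -> : (m.-1 - i < m)%N by lia.
by have -> : (m.-1 - (m.-1 - i) = i)%N by lia.
Qed.

Lemma fracE (x : Kq) : x = (\n_(repr x))%:F / (\d_(repr x))%:F.
Proof.
have d0 := denom_ratioP (repr x).
apply: (@mulIf _ ((\d_(repr x))%:F)); first by rewrite tofrac_eq0.
rewrite divfK ?tofrac_eq0 // -{1}[x]reprK; unlock FracField.tofrac.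
rewrite -[LHS]FracField.pi_mul; apply/eqmodP => /=.
by rewrite /FracField.equivf /FracField.mulf /= !numden_Ratio ?mulr1 ?mulf_neq0
  ?oner_neq0 // mulrC.
Qed.

Lemma barE (a b : {poly R[i]}) : b != 0 ->
  bar (a%:F / b%:F) = eval_qV a / eval_qV b.
Proof.
move=> b0; set x := _ / _; rewrite /bar.
have d0 := denom_ratioP (repr x).
apply/eqP; rewrite eqr_div ?eval_qV_eq0 // -!rmorphM; apply/eqP; congr eval_qV.
apply/eqP; rewrite -tofrac_eq !rmorphM /= -eqr_div ?tofrac_eq0 //.
by rewrite -fracE.
Qed.

Lemma bar_is_zmod_morphism : zmod_morphism bar.
Proof.
move=> x y; rewrite [x]fracE [y]fracE.
set a := \n_ _; set b := \d_ _; set c := \n_ _; set d := \d_ _.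
have b0 : b != 0 := denom_ratioP _; have d0 : d != 0 := denom_ratioP _.
rewrite -mulNr addf_div ?tofrac_eq0 // -!rmorphN -!rmorphM -rmorphD.
rewrite !barE ?mulf_neq0 // !(rmorphD, rmorphM, rmorphN) /=.
by rewrite -addf_div ?eval_qV_eq0 // mulNr.
Qed.

Lemma bar_is_monoid_morphism : monoid_morphism bar.
Proof.
have barF a : bar a%:F = eval_qV a.
  by have := barE a (oner_neq0 _); rewrite !rmorph1 !divr1.
split=> [|x y]; first by rewrite -[1]tofrac1 barF rmorph1.
rewrite [x]fracE [y]fracE.
set a := \n_ _; set b := \d_ _; set c := \n_ _; set d := \d_ _.
have b0 : b != 0 := denom_ratioP _; have d0 : d != 0 := denom_ratioP _.
by rewrite mulf_div -!rmorphM !barE ?mulf_neq0 // !rmorphM mulf_div.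
Qed.

HB.instance Definition _ :=
  GRing.isZmodMorphism.Build Kq Kq bar bar_is_zmod_morphism.
HB.instance Definition _ :=
  GRing.isMonoidMorphism.Build Kq Kq bar bar_is_monoid_morphism.

Lemma bar_tofrac (a : {poly R[i]}) : bar a%:F = eval_qV a.
Proof. by have := barE a (oner_neq0 _); rewrite !rmorph1 !divr1. Qed.

Lemma bar_scal c : bar (scal c) = scal c.
Proof. by rewrite bar_tofrac /eval_qV map_polyC hornerC. Qed.

Lemma bar_q : bar q = q^-1.
Proof. by rewrite bar_tofrac /eval_qV map_polyX hornerX. Qed.

End GroundField.

Section Diagrams.
Variable n : nat.

(* inl i is the bottom vertex i.+1, inr i the top vertex i.+1. *)
Definition vertex : finType := ('I_n + 'I_n)%type.

(* Position on the boundary of the strip: bottom line from left to right, then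
   top line from right to left. *)
Definition bpos (u : vertex) : nat :=
  match u with inl i => i | inr i => (2 * n - i.+1)%N end.

(* A diagram is given by the map sending each vertex to the one it is linked
   to. *)
Definition is_diagram (D : {ffun vertex -> vertex}) : bool :=
  [&& [forall u, D (D u) == u], [forall u, D u != u]
    & [forall u, forall v,
        ~~ [&& (bpos u < bpos v)%N, (bpos v < bpos (D u))%N
             & (bpos (D u) < bpos (D v))%N]]].

Definition diagram := {D : {ffun vertex -> vertex} | is_diagram D}.

Definition id_matching : {ffun vertex -> vertex} :=
  [ffun u => match u with inl i => inr i | inr i => inl i end].

Lemma id_matchingP : is_diagram id_matching.
Proof.
apply/and3P; split; apply/forallP => -[] x /=; rewrite ?ffunE //=.
- by apply/forallP => -[] y; rewrite !ffunE /=; have := ltn_ord x;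
    have := ltn_ord y; lia.
- by apply/forallP => -[] y; rewrite !ffunE /=; have := ltn_ord x;
    have := ltn_ord y; lia.
Qed.

Definition id_diagram : diagram := exist _ id_matching id_matchingP.

Definition gen_matching (a b : 'I_n) : {ffun vertex -> vertex} :=
  [ffun u => match u with
    | inl x => if x == a then inl b else if x == b then inl a else inr x
    | inr x => if x == a then inr b else if x == b then inr a else inl x
    end].

Lemma gen_matchingP (a b : 'I_n) : b = a.+1 :> nat ->
  is_diagram (gen_matching a b).
Proof.
move=> ab.
have ltb := ltn_ord b.
have ab' : (b == a) = false by apply/negP => /eqP/(congr1 val) /=; lia.
have ba' : (a == b) = false by rewrite eq_sym.
have ifE (x : 'I_n) : [\/ x = a, x = b |
    [/\ (x == a) = false, (x == b) = false, val x <> val a & val x <> val b]].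
  have [->|xa] := eqVneq x a; first by constructor 1.
  have [->|xb] := eqVneq x b; first by constructor 2.
  by constructor 3; split=> // /val_inj e; [move: xa|move: xb];
    rewrite e eqxx.
have genE u : gen_matching a b u = match u with
    | inl x => if x == a then inl b else if x == b then inl a else inr x
    | inr x => if x == a then inr b else if x == b then inr a else inl x
    end by rewrite ffunE.
apply/and3P; split; apply/forallP => -[] x.
1-4: case: (ifE x) => [->|->|[xa xb _ _]];
  do 3 rewrite ?genE ?eqxx ?ab' ?ba' ?xa ?xb /= //; exact: negbT.
all: apply/forallP => -[] y; rewrite !genE /=; have := ltn_ord x;
  have := ltn_ord y;
  case: (ifE x) => [->|->|[xa xb ? ?]]; case: (ifE y) => [->|->|[ya yb ? ?]];
  rewrite ?eqxx ?ab' ?xa ?xb ?ya ?yb /=; move: ab; lia.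
Qed.

(* For a = i.-1 and b = i (0-based), this is the diagram e_i. *)
Definition gen_diagram (a b : 'I_n) (ab : b = a.+1 :> nat) : diagram :=
  exist _ (gen_matching a b) (gen_matchingP ab).

(* Stacking D' on top of D: inl u are the outer vertices, inr i is the vertex
   obtained by identifying the top vertex i of D with the bottom vertex i of
   D'. *)
Definition stack_vertex : finType := (vertex + 'I_n)%type.

Definition in_lower (u : vertex) : stack_vertex :=
  match u with inl i => inl (inl i) | inr i => inr i end.

Definition in_upper (u : vertex) : stack_vertex :=
  match u with inl i => inr i | inr i => inl (inr i) end.

Definition stack_rel (D' D : diagram) : rel stack_vertex := fun x y =>
  [exists u, (in_lower u == x) && (in_lower (val D u) == y)] ||
  [exists u, (in_upper u == x) && (in_upper (val D' u) == y)].

Definition is_stack (D' D D'' : diagram) : bool :=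
  [forall u : vertex, forall v : vertex,
    (val D'' u == v) ==
    (u != v) && connect (stack_rel D' D) (inl u) (inl v)].

Definition nloops (D' D : diagram) : nat :=
  n_comp (stack_rel D' D)
    [pred x | [forall u : vertex, ~~ connect (stack_rel D' D) x (inl u)]].

Definition in_ind_basis (k : nat) (D : diagram) : bool :=
  [forall i : 'I_n, forall j : 'I_n, (val D (inl i) == inl j) ==>
    ~~ ((i < k)%N && (j < k)%N) && ~~ ((k <= i)%N && (k <= j)%N)].

(* A sign is a boolean, true for +. The label (k_n, ..., k_1) is the tuple k
   read from left to right, so that k_i is the sign at (0-based) position
   n - i. *)
Definition nminus (k : n.-tuple bool) : nat := count negb k.

Section Label.
Variable k : n.-tuple bool.

(* Positions are processed from right to left. The second component lists the
   not yet linked positions of signs -, from left to right, i.e. by decreasing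
   index. *)
Definition top_step (a : 'I_n) (LU : seq ('I_n * 'I_n) * seq 'I_n) :=
  let: (L, U) := LU in
  if tnth k a then
    if U is b :: U' then ((a, b) :: L, U') else (L, U)
  else (L, a :: U).

Definition top_links : seq ('I_n * 'I_n) :=
  (foldr top_step ([::], [::]) (enum 'I_n)).1.

Definition top_link (x y : 'I_n) : bool :=
  ((x, y) \in top_links) || ((y, x) \in top_links).

Definition bottom_arc (x y : 'I_n) : bool :=
  [exists i : 'I_(size top_links),
    (x.+1 == nminus k - i)%N && (y.+1 == nminus k + 1 + i)%N].

Definition bottom_link (x y : 'I_n) : bool := bottom_arc x y || bottom_arc y x.

Definition free_top : seq 'I_n :=
  [seq x <- enum 'I_n | ~~ [exists y, top_link x y]].

Definition free_bottom : seq 'I_n :=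
  [seq x <- enum 'I_n | ~~ [exists y, bottom_link x y]].

Definition through_link (x y : 'I_n) : bool :=
  [&& x \in free_bottom, y \in free_top
    & index x free_bottom == index y free_top].

Definition label_link (u v : vertex) : bool :=
  match u, v with
  | inl x, inl y => bottom_link x y
  | inr x, inr y => top_link x y
  | inl x, inr y => through_link x y
  | inr x, inl y => through_link y x
  end.

Definition label_diagram : {ffun vertex -> vertex} :=
  [ffun u => odflt u [pick v | label_link u v]].

End Label.

End Diagrams.

Section TensorSpace.
Variable R : realType.
Local Notation K := (Kq R).
Local Notation q := (q R).

(* V^{\otimes n}, by coordinates in the basis v_{t_1} \otimes ... \otimes
   v_{t_n}. *)
Definition Vn (n : nat) : vectType K := {ffun n.-tuple bool -> K^o}.

Definition vbasis_elt n (t : n.-tuple bool) : Vn n :=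
  [ffun s => (s == t)%:R].

Definition pairing n (x y : Vn n) : K :=
  \sum_(t : n.-tuple bool) x t * y (rev_tuple t).

(* v_-^{\otimes k} \otimes v_+^{\otimes n-k} *)
Definition minus_plus n (k : nat) : Vn n :=
  vbasis_elt [tuple of mkseq (fun i => ~~ (i < k)%N) n].

(* A t s is the coefficient of v_t in A v_s. *)
Definition endoV := bool -> bool -> K.

Definition opI : endoV := fun t s => (t == s)%:R.
Definition opKV : endoV := fun t s =>
  if t == s then (if s then q^-1 else q) else 0.
Definition opE : endoV := fun t s => (t && ~~ s)%:R.
Definition opF : endoV := fun t s => (~~ t && s)%:R.

Definition tensor_op n (A : 'I_n -> endoV) (w : Vn n) : Vn n :=
  [ffun t : n.-tuple bool =>
    \sum_(s : n.-tuple bool) (\prod_(j < n) A j (tnth t j) (tnth s j)) * w s].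

Definition Fn n (w : Vn n) : Vn n :=
  \sum_(j < n) tensor_op (fun i => if (i < j)%N then opI
                                   else if i == j then opF else opKV) w.

Definition tensor_last m (x : Vn m) (v : bool -> K) : Vn m.+1 :=
  [ffun t : m.+1.-tuple bool =>
    x [tuple tnth t (widen_ord (leqnSn m) i) | i < m] * v (tnth t ord_max)].

Definition slice m (w : Vn m.+1) (b : bool) : Vn m :=
  [ffun t : m.-tuple bool => w (rcons_tuple t b)].

(* On V^{\otimes 0} = K, theta is the bar involution; the recursion then gives
   theta_1 (v_\pm) = v_\pm. *)
Fixpoint theta (m : nat) : Vn m -> Vn m :=
  match m return Vn m -> Vn m with
  | 0 => fun w => [ffun t => bar (w t)]
  | m'.+1 => fun w =>
      \sum_(b : bool)
        (tensor_last (theta (slice w b)) (opI^~ b) -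
         (q - q^-1) *: tensor_last (Fn (theta (slice w b))) (opE^~ b))
  end.

Lemma Fn_is_linear n (a : K) (x y : Vn n) : Fn (a *: x + y) = a *: Fn x + Fn y.
Proof.
rewrite /Fn scaler_sumr -big_split; apply: eq_bigr => j _; apply/ffunP => t.
rewrite !ffunE -[a *: (\sum_s _ : K^o)]/(a * _) mulr_sumr -big_split /=.
apply: eq_bigr => s _.
by rewrite !ffunE mulrDr; congr (_ + _); rewrite [a *: _]/(a * _) mulrCA.
Qed.

Lemma tensor_last_is_linear m (v : bool -> K) (a : K) (x y : Vn m) :
  tensor_last (a *: x + y) v = a *: tensor_last x v + tensor_last y v.
Proof.
apply/ffunP => t; rewrite !ffunE mulrDl; congr (_ + _).
by symmetry; exact: mulrA.
Qed.

Lemma theta_antilinear m (a : K) (x y : Vn m) :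
  theta (a *: x + y) = bar a *: theta x + theta y.
Proof.
elim: m => [|m IHm] in a x y *.
  by apply/ffunP => t; rewrite !ffunE rmorphD rmorphM.
rewrite /= scaler_sumr -big_split; apply: eq_bigr => b _ /=.
have -> : slice (a *: x + y) b = a *: slice x b + slice y b.
  by apply/ffunP => t; rewrite !ffunE.
rewrite IHm Fn_is_linear !tensor_last_is_linear.
move: (tensor_last _ _) (tensor_last _ _) => A A'.
move: (tensor_last _ _) (tensor_last _ _) (bar a) (q - q^-1) => B B' c d.
rewrite [c *: (_ - _)]scalerBr scalerDr opprD addrACA.
by rewrite [d *: (c *: _)]scalerA [d * c]mulrC -scalerA.
Qed.

Lemma theta_tensor m (x : Vn m) (b : bool) :
  theta (tensor_last x (opI^~ b)) =
  tensor_last (theta x) (opI^~ b) -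
    (q - q^-1) *: tensor_last (Fn (theta x)) (opE^~ b).
Proof.
have tl0 v : tensor_last (0 : Vn m) v = 0.
  by apply/ffunP => t; rewrite !ffunE mul0r.
have th0 : theta (0 : Vn m) = 0.
  have := theta_antilinear 1 (0 : Vn m) 0.
  by rewrite rmorph1 !scale1r addr0 => /eqP; rewrite -subr_eq subrr => /eqP <-.
have F0 : Fn (0 : Vn m) = 0.
  have := Fn_is_linear 1 (0 : Vn m) 0.
  by rewrite !scale1r addr0 => /eqP; rewrite -subr_eq subrr => /eqP <-.
rewrite /= (bigD1 b) //= [X in _ + X]big1 ?addr0 => [|c cb].
  suff -> : slice (tensor_last x (opI^~ b)) b = x by [].
  apply/ffunP => t; rewrite !ffunE.
  have -> : [tuple tnth (rcons_tuple t b) (widen_ord (leqnSn m) i) | i < m] = t.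
    apply: eq_from_tnth => i; rewrite tnth_mktuple (tnth_nth b) /= nth_rcons.
    by rewrite size_tuple ltn_ord -tnth_nth.
  by rewrite (tnth_nth b) /= nth_rcons size_tuple ltnn eqxx /opI eqxx mulr1.
suff -> : slice (tensor_last x (opI^~ b)) c = 0.
  by rewrite th0 F0 !tl0 scaler0 subr0.
apply/ffunP => t; rewrite !ffunE (tnth_nth b) /= nth_rcons size_tuple ltnn.
by rewrite eqxx /opI (negPf cb) mulr0.
Qed.

Lemma theta1 (b : bool) : theta (vbasis_elt [tuple b]) = vbasis_elt [tuple b].
Proof.
have t0 (u v : 0.-tuple bool) : (u == v) = true.
  by rewrite [u]tuple0 [v]tuple0 eqxx.
have e (c : bool) :
    vbasis_elt [tuple c] = tensor_last (vbasis_elt [tuple]) (opI^~ c) :> Vn 1.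
  apply/ffunP => t; rewrite !ffunE t0 mul1r.
  rewrite /opI; case/tupleP: t => a t; rewrite [t]tuple0 (tnth_nth a) /=.
  by rewrite -val_eqE /= eqseq_cons andbT.
rewrite {1}e theta_tensor [Fn _]big_ord0.
have -> : theta (vbasis_elt [tuple]) = vbasis_elt [tuple] :> Vn 0.
  by apply/ffunP => t; rewrite !ffunE rmorph_nat.
have -> : tensor_last (0 : Vn 0) (opE^~ b) = 0.
  by apply/ffunP => t; rewrite !ffunE mul0r.
by rewrite scaler0 subr0 -e.
Qed.

Definition sgnb (b : bool) : int := if b then 1 else -1.

(* k_1 + ... + k_m *)
Definition psum n (k : n.-tuple bool) (m : nat) : int :=
  \sum_(i < n | (i < m)%N) sgnb (tnth (rev_tuple k) i).

Definition support_cond n (k l : n.-tuple bool) : bool :=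
  (psum l n == psum k n) && [forall m : 'I_n, psum k m.+1 <= psum l m.+1].

Definition in_qVZqV (x : K) : Prop :=
  exists p : {poly int}, x = q^-1 * (map_poly intr p).[q^-1].

Definition is_canonical n (k : n.-tuple bool) (b : Vn n) : Prop :=
  theta b = b /\
  exists c : n.-tuple bool -> K, (forall l, in_qVZqV (c l)) /\
    b - vbasis_elt k =
      \sum_(l : n.-tuple bool | support_cond k l) c l *: vbasis_elt l.

Definition TL (n : nat) : vectType K := {ffun diagram n -> K^o}.

Definition tl_basis n (D : diagram n) : TL n := [ffun D' => (D' == D)%:R].

Definition tl_mul n (x y : TL n) : TL n :=
  \sum_(D' : diagram n) \sum_(D : diagram n)
    \sum_(D'' : diagram n | is_stack D' D D'')
      (x D' * y D * (- q - q^-1) ^+ nloops D' D) *: tl_basis D''.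

(* Rows and columns are indexed by the pairs of signs of the two components. *)
Definition gen_mx (t s : bool * bool) : K :=
  match t, s with
  | (true, false), (true, false) => - q^-1
  | (true, false), (false, true) => 1
  | (false, true), (true, false) => 1
  | (false, true), (false, true) => - q
  | _, _ => 0
  end.

(* gen_mx on the components i, j, identity on the others *)
Definition gen_op n (i j : 'I_n) (w : Vn n) : Vn n :=
  [ffun t : n.-tuple bool =>
    \sum_(s : n.-tuple bool |
          [forall l, (l != i) && (l != j) ==> (tnth s l == tnth t l)])
      gen_mx (tnth t i, tnth t j) (tnth s i, tnth s j) * w s].

(* The product x y of TL_n acts on the right as first x, then y. For e_i, with
   a = i.-1 and b = i, the components n-i and n-i+1 from the left are (0-based)
   rev_ord b and rev_ord a. *)
Definition is_zeta_star n (zeta : TL n -> 'End(Vn n)) : Prop :=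
  [/\ linear zeta,
      zeta (tl_basis (id_diagram n)) = \1%VF,
      forall x y, zeta (tl_mul x y) = (zeta y \o zeta x)%VF
    & forall (a b : 'I_n) (ab : b = a.+1 :> nat) (w : Vn n),
        zeta (tl_basis (gen_diagram ab)) w = gen_op (rev_ord b) (rev_ord a) w].

End TensorSpace.

(* Main.v *)
Require Import Defs.
From HB Require Import structures.
From mathcomp Require Import all_boot all_order all_algebra.
From mathcomp Require Import perm fraction reals complex.
From mathcomp Require Import zify ring.

(** Pairing with a diagram of an induced module is evaluation of an element of
the dual canonical basis, so the theorem says that the canonical and the dual
canonical bases are dual to each other.

Reading the boundary of the strip from the bottom vertex k + 1 onwards turns a
diagram of the module induced from TL_k and TL_(n-k) into a well-bracketed
word of length 2n: the first n - k letters open, the last k letters close, and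
the n letters in between, one for each top vertex, form the label of the
diagram.  A non-crossing matching is determined by its opening letters, so the
diagrams of all these modules are in bijection with the labels ([lab_inj],
[exists_diagram]), and running the bracket matching by hand shows that the
diagram attached to a label by the recursive construction is the one with this
label ([label_diagram_lab]).

Let D be such a diagram, with label t.  The functional
w |-> < v_-^k v_+^(n-k), zeta(D) w > has the value (-q^-1)^f at v_l if l gives
opposite signs to the two ends of every link between top vertices and agrees with
t at the other top vertices, where f is the number of links on which l and t
disagree, and the value 0 otherwise.  This is proved by induction on t: if t is not sorted, it has two neighbouring signs whose
exchange gives a smaller label, and D is the product of the corresponding
generator with the diagram of that smaller label, without any closed loop
([is_stack_surg], [nloops_surg], [dual_coef_surg]).

Two properties of these functionals are needed.
- They form a unitriangular family: the coefficient at v_t is 1, and the others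
  lie in q^-1 Z[q^-1] and vanish unless l is below t ([oriented_support],
  [dual_vec_qV]).  So for each label k exactly one vector is dual to the
  functional of k, and inverting the family shows that it has the shape required
  of the canonical basis element ([exists_dual_basis]).
- They exchange theta with the bar involution.  Indeed the generators commute
  with theta ([gen_op_theta]), and taking the coefficient at
  v_+ ... v_+ v_- ... v_- exchanges theta with the bar involution because this
  vector is minimal ([theta_coef_min]).

By the second property the dual vector is fixed by theta, hence canonical.
Conversely the functionals have bar-invariant values on a canonical element,
and these values differ from those on the dual vector by elements of
q^-1 Z[q^-1].  The only bar-invariant element there is 0 ([bar_fixed_qVZqV]). *)

Set Implicit Arguments.
Unset Strict Implicit.
Unset Printing Implicit Defensive.

(** * Diagrams of the induced module and their labels *)

Lemma card_ord_itv n a b : b <= n -> #|[pred i : 'I_n | a <= i < b]| = b - a.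
Proof.
move=> bn; rewrite -sum1_card -[RHS]muln1 -sum_nat_const_nat.
rewrite (big_nat_widen a b n) // (big_nat_widenl a 0) // big_mkord.
by apply: eq_bigl => i; rewrite inE andbC.
Qed.

Section Matching.
Variable n : nat.
Implicit Types (D : diagram n) (u v : vertex n).

Lemma tnth_rev_tuple T (s : n.-tuple T) j :
  tnth (rev_tuple s) j = tnth s (rev_ord j).
Proof.
by have x0 := tnth s j; rewrite !(tnth_nth x0) /= nth_rev size_tuple ?ltn_ord.
Qed.

Lemma diagK D : involutive (val D).
Proof. by move=> u; case/and3P: (valP D) => /forallP/(_ u)/eqP. Qed.

Lemma diag_neq D u : val D u != u.
Proof. by case/and3P: (valP D) => _ /forallP/(_ u). Qed.

Lemma diag_noncross D u v :
  ~~ [&& bpos u < bpos v, bpos v < bpos (val D u)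
       & bpos (val D u) < bpos (val D v)].
Proof. by case/and3P: (valP D) => _ _ /forallP/(_ u)/forallP/(_ v). Qed.

Lemma diag_inj D : injective (val D).
Proof. exact: inv_inj (@diagK D). Qed.

Lemma bpos_lt u : bpos u < 2 * n.
Proof. by case: u => i /=; have := ltn_ord i; lia. Qed.

Lemma bpos_inj : injective (@bpos n).
Proof.
case=> i [] j /= e; have := ltn_ord i; have := ltn_ord j.
- by move=> _ _; congr inl; apply: val_inj.
- by lia.
- by lia.
- by move=> ? ?; congr inr; apply: val_inj => /=; lia.
Qed.

(** Position on the boundary when it is read from the bottom vertex k onwards:
the bottom vertices k, k+1, ..., then the top line from right to left, then the
bottom vertices 0, ..., k-1. *)
Definition rpos k u := if bpos u < k then bpos u + 2 * n - k else bpos u - k.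

Lemma rpos_inj k : k <= n -> injective (rpos k).
Proof.
move=> kn u v; rewrite /rpos => e; apply: bpos_inj.
move: (bpos_lt u) (bpos_lt v) e.
by case: (ltnP (bpos u) k); case: (ltnP (bpos v) k); lia.
Qed.

(** Being non-crossing depends only on the cyclic order of the boundary. *)
Lemma rpos_noncross k D u v : k <= n ->
  ~~ [&& rpos k u < rpos k v, rpos k v < rpos k (val D u)
       & rpos k (val D u) < rpos k (val D v)].
Proof.
(* One of the four cyclic rotations of (u, v, D u, D v) is increasing for bpos. *)
move=> kn; move: (diag_noncross D u v) (diag_noncross D v (val D u))
  (diag_noncross D (val D u) (val D v)) (diag_noncross D (val D v) u).
rewrite !diagK /rpos.
move: (bpos_lt u) (bpos_lt v) (bpos_lt (val D u)) (bpos_lt (val D v)).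
case: (ltnP (bpos u) k); case: (ltnP (bpos v) k);
  case: (ltnP (bpos (val D u)) k); case: (ltnP (bpos (val D v)) k); lia.
Qed.

Definition closes k D u := rpos k (val D u) < rpos k u.

Lemma closes_diag k D u : k <= n -> closes k D (val D u) = ~~ closes k D u.
Proof.
move=> kn; rewrite /closes diagK -leqNgt [RHS]leq_eqVlt.
suff /negPf -> : rpos k u != rpos k (val D u) by [].
by apply: contraNneq (diag_neq D u) => /(rpos_inj kn) {1}->; rewrite diagK.
Qed.

(** This is how the basis of the induced module is used: in the rotated order
the bottom vertices from k on come first, so that none of them is linked to
another one exactly when all of them open a link; likewise the others close. *)
Lemma closes_bottom k D i : k <= n -> in_ind_basis k D ->
  closes k D (inl i) = (i < k).
Proof.
move=> kn /forallP/(_ i)/forallP h; rewrite /closes /rpos /=.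
have := ltn_ord i; case e : (val D (inl i)) => [j|j] /=.
  have := h j; rewrite e eqxx /=; have := ltn_ord j.
  by case: (ltnP i k); case: (ltnP j k); lia.
have := ltn_ord j; case: (ltnP i k); case: (ltnP (2 * n - j.+1) k); lia.
Qed.

Lemma closes_top k D i j : k <= n -> val D (inr i) = inr j ->
  closes k D (inr i) = (i < j).
Proof.
move=> kn e; rewrite /closes /rpos e /=; have := ltn_ord i; have := ltn_ord j.
by case: (ltnP (2 * n - j.+1) k); case: (ltnP (2 * n - i.+1) k); lia.
Qed.

Lemma closes_through k D i j : k <= n -> val D (inr i) = inl j ->
  closes k D (inr i) = (k <= j).
Proof.
move=> kn e; rewrite /closes /rpos e /=; have := ltn_ord i; have := ltn_ord j.
by case: (ltnP j k); case: (ltnP (2 * n - i.+1) k); lia.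
Qed.

(** The sign is + at the closing vertices. The reversal accounts for the tensor
factors being numbered against the vertices. *)
Definition lab k D : n.-tuple bool :=
  [tuple closes k D (inr (rev_ord i)) | i < n].

Lemma tnth_lab k D j : tnth (lab k D) (rev_ord j) = closes k D (inr j).
Proof. by rewrite tnth_mktuple rev_ordK. Qed.

(** A non-crossing matching is determined by its closing vertices. At the first
closing vertex where two matchings with the same closing vertices differ, one of
them links it further to the left; the inner of the two partners opens in both
matchings, hence is linked there to an earlier closing vertex, where the
matchings agree. *)
Lemma lab_inj k D D' : k <= n -> in_ind_basis k D -> in_ind_basis k D' ->
  lab k D = lab k D' -> D = D'.
Proof.
move=> kn Dk Dk' e.
have cE u : closes k D u = closes k D' u.
  by case: u => i; rewrite ?closes_bottom // -!tnth_lab e.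
have rlt (E : diagram n) u v : val E u != v -> rpos k (val E u) != rpos k v.
  by apply: contraNneq => /(rpos_inj kn) ->.
have nested (E E' : diagram n) u : (forall v, closes k E v = closes k E' v) ->
    closes k E u ->
    (forall v, rpos k v < rpos k u -> closes k E v -> val E v = val E' v) ->
    rpos k (val E u) < rpos k (val E' u) -> False.
  move=> EE uc IH lt; set b := val E' u.
  have bo : ~~ closes k E b by rewrite EE closes_diag // negbK -EE.
  have bc : closes k E (val E b) by rewrite closes_diag.
  have cu : val E b != u.
    apply/eqP => eb; have ub : val E u = b by rewrite -eb diagK.
    by move: lt; rewrite ub ltnn.
  have cltu : rpos k (val E b) < rpos k u.
    have uE : rpos k b < rpos k u.
      by move: uc; rewrite EE /closes.
    have := rpos_noncross E (val E u) b kn; rewrite diagK => X.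
    by move: (rlt E b u cu) X lt; rewrite -/b; lia.
  have := IH _ cltu bc; rewrite diagK => /(congr1 (val E')); rewrite /b !diagK.
  by move/eqP; rewrite eq_sym (negPf cu).
have main u : closes k D u -> val D u = val D' u.
  have [m] := ubnP (rpos k u); elim: m u => // m IHm u um uc.
  apply: (rpos_inj kn).
  case: (ltngtP (rpos k (val D u)) (rpos k (val D' u))) => // lt; exfalso.
    by apply: (nested D D' u) => // v vu vc; apply: IHm => //; lia.
  apply: (nested D' D u) => //; first by rewrite -cE.
  by move=> v vu vc; symmetry; apply: IHm; rewrite ?cE //; lia.
apply: val_inj; apply/ffunP => u; case uc : (closes k D u); first exact: main.
have /main : closes k D (val D' u) by rewrite cE closes_diag // -cE uc.
by rewrite diagK => {1}<-; rewrite diagK.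
Qed.

(** Among the 2n vertices, n close: k of them at the bottom, the others are the
signs + of the label. *)
Lemma nminus_lab k D : k <= n -> in_ind_basis k D -> nminus (lab k D) = k.
Proof.
move=> kn Dk.
have S2 : \sum_u closes k D u = \sum_u ~~ closes k D u.
  rewrite (reindex_inj (@diag_inj D)); apply: eq_bigr => u _.
  by rewrite closes_diag.
have := sum1_card [pred u : vertex n | true].
rewrite (eq_bigr (fun u => closes k D u + ~~ closes k D u)); last first.
  by move=> u _; case: (closes _ _ _).
rewrite big_split /= -S2 cardT -cardT card_sum card_ord.
have -> : \sum_u closes k D u =
    \sum_(i < n) (i < k) + \sum_(i < n) closes k D (inr i).
  rewrite big_sumType; congr (_ + _); apply: eq_bigr => i _.
  by rewrite closes_bottom.
have -> : \sum_(i < n) (i < k) = k.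
  rewrite -[RHS]subn0 -(card_ord_itv 0 kn) -sum1_card [RHS]big_mkcond /=.
  by apply: eq_bigr => i _; rewrite inE /=; case: ltnP.
have -> : nminus (lab k D) = \sum_(i < n) ~~ closes k D (inr i).
  rewrite /nminus -sum1_count big_tuple big_mkcond (reindex_inj rev_ord_inj).
  by apply: eq_bigr => i _; rewrite tnth_lab; case: closes.
have : \sum_(i < n) closes k D (inr i) + \sum_(i < n) ~~ closes k D (inr i) = n.
  rewrite -big_split /= -[RHS]card_ord -sum1_card; apply: eq_big => // i _.
  by case: closes.
by lia.
Qed.

End Matching.

(** * Multiplying a diagram by a generator *)

Lemma cross_adj1 c x z : ~~ [&& c.+1 < x, x < c & z]. Proof. by lia. Qed.
Lemma cross_adj2 c x z : ~~ [&& c < x, x < c.+1 & z]. Proof. by lia. Qed.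
Lemma cross_adj3 c x y : ~~ [&& x < c.+1, c.+1 < y & y < c]. Proof. by lia. Qed.
Lemma cross_adj4 c x y : ~~ [&& x < c, c < y & y < c.+1]. Proof. by lia. Qed.

(** The neighbouring positions p and p' are linked to P and P'. A chord from v to
w that crosses the chord from P to P' would cross one of these two links. *)
Lemma crossL (P P' p p' v w : nat) : p = p'.+1 \/ p' = p.+1 ->
  v != p -> v != p' -> w != p -> w != p' ->
  ~~ [&& P < v, v < p & p < w] -> ~~ [&& p' < v, v < P' & P' < w] ->
  ~~ [&& v < P', P' < w & w < p'] -> ~~ [&& P < v, v < P' & P' < w].
Proof. by lia. Qed.

Lemma crossR (P P' p p' u w : nat) : p = p'.+1 \/ p' = p.+1 ->
  u != p -> u != p' -> w != p -> w != p' ->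
  ~~ [&& u < P, P < w & w < p] -> ~~ [&& p < u, u < P & P < w] ->
  ~~ [&& u < p', p' < w & w < P'] -> ~~ [&& u < P, P < w & w < P'].
Proof. by lia. Qed.

Section Surgery.
Variables (n : nat) (D : diagram n) (a b : 'I_n).
Hypotheses (ab : b = a.+1 :> nat) (nab : val D (inr a) != inr b).
Implicit Types u v : vertex n.

Let A := val D (inr a).
Let B := val D (inr b).

(** The outcome of stacking the generator at a and b on top of [D]. *)
Definition surg_matching : {ffun vertex n -> vertex n} :=
  [ffun u => if u == inr a then inr b else if u == inr b then inr a
             else if u == A then B else if u == B then A else val D u].

Variant surg_spec u : vertex n -> Type :=
| Surg1 of u = inr a : surg_spec u (inr b)
| Surg2 of u = inr b : surg_spec u (inr a)
| Surg3 of u = A & u != inr a & u != inr b : surg_spec u B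
| Surg4 of u = B & u != inr a & u != inr b : surg_spec u A
| Surg5 of u != inr a & u != inr b & u != A & u != B : surg_spec u (val D u).

Lemma surgP u : surg_spec u (surg_matching u).
Proof.
rewrite ffunE; case: eqVneq => [ua|ua]; first exact: Surg1.
case: eqVneq => [ub|ub]; first exact: Surg2.
case: eqVneq => [uA|uA]; first exact: Surg3.
by case: eqVneq => [uB|uB]; [exact: Surg4|exact: Surg5].
Qed.

Lemma surg_facts :
  [/\ A != inr b, B != inr a, A != inr a, B != inr b & A != B].
Proof.
have aNb : a != b by rewrite -val_eqE /= ab; lia.
split=> //; rewrite /A /B ?diag_neq //.
  by apply: contraNneq nab => <-; rewrite diagK.
by apply: contraNneq aNb => /diag_inj[->].
Qed.

Lemma surgE : [/\ surg_matching (inr a) = inr b, surg_matching (inr b) = inr a,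
  surg_matching A = B, surg_matching B = A &
  forall u, u != inr a -> u != inr b -> u != A -> u != B ->
    surg_matching u = val D u].
Proof.
have [Ab Ba Aa Bb AB] := surg_facts.
split.
- by rewrite ffunE eqxx.
- by rewrite ffunE eqxx; case: eqP => // ->.
- by rewrite ffunE (negPf Aa) (negPf Ab) eqxx.
- by rewrite ffunE (negPf Ba) (negPf Bb) eqxx eq_sym (negPf AB).
- by move=> u /negPf ua /negPf ub /negPf uA /negPf uB; rewrite ffunE ua ub uA uB.
Qed.

Lemma diag_notAB u : u != inr a -> u != inr b -> val D u != A /\ val D u != B.
Proof.
move=> ua ub; rewrite /A /B; split.
  by apply: contraNneq ua => /diag_inj ->.
by apply: contraNneq ub => /diag_inj ->.
Qed.

(** The vertices a and b are neighbours on the boundary, so the new link between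
their partners runs along the two old ones. *)
Lemma surg_matchingP : is_diagram surg_matching.
Proof.
have [Ab Ba Aa Bb AB] := surg_facts.
have aNb : inr a != inr b :> vertex n.
  by apply/eqP => -[/(congr1 val)] /=; rewrite ab; lia.
have [Ea Eb EA EB EO] := surgE.
apply/and3P; split; apply/forallP => u.
- case: (surgP u) => [->|->|-> _ _|-> _ _|ua ub uA uB]; rewrite ?Ea ?Eb ?EA ?EB //.
  have [DA DB] := diag_notAB ua ub.
  rewrite EO ?diagK //.
    by apply: contraNneq uA => e; rewrite /A -e diagK.
  by apply: contraNneq uB => e; rewrite /B -e diagK.
- case: (surgP u) => [->|->|-> _ _|-> _ _|ua ub uA uB] //.
  + by rewrite eq_sym.
  + by rewrite eq_sym.
  + exact: diag_neq.
apply/forallP => v.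
have adj : bpos (inr a : vertex n) = (bpos (inr b : vertex n)).+1.
  by rewrite /= ab; have := ltn_ord b; have := ltn_ord a; lia.
have X c d := diag_noncross D c d.
have neq c d : c != d -> bpos c != bpos d by apply: contraNneq => /bpos_inj ->.
have sA c : c != A -> val D c != inr a.
  by apply: contraNneq => e; rewrite /A -e diagK.
have sB c : c != B -> val D c != inr b.
  by apply: contraNneq => e; rewrite /B -e diagK.
have DA : val D A = inr a by rewrite diagK.
have DB : val D B = inr b by rewrite diagK.
have adj' : (bpos (inr b : vertex n)).+1 = bpos (inr a : vertex n) by [].
case: (surgP u) => [->|->|-> _ _|-> _ _|ua ub uA uB].
- by rewrite adj; exact: cross_adj1.
- by rewrite adj; exact: cross_adj2.
- case: (surgP v) => [->|->|-> _ _|-> _ _|va vb vA vB].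
  + by rewrite adj; exact: cross_adj3.
  + by rewrite adj; exact: cross_adj4.
  + by rewrite ltnn.
  + by rewrite ltnn andbF.
  move: (X A v) (X (inr b) v) (X v B); rewrite DA DB.
  by apply: crossL; rewrite ?neq ?sA ?sB //; left.
- case: (surgP v) => [->|->|-> _ _|-> _ _|va vb vA vB].
  + by rewrite adj; exact: cross_adj3.
  + by rewrite adj; exact: cross_adj4.
  + by rewrite ltnn andbF.
  + by rewrite ltnn.
  move: (X B v) (X (inr a) v) (X v A); rewrite DA DB.
  by apply: crossL; rewrite ?neq ?sA ?sB //; right.
- case: (surgP v) => [->|->|-> _ _|-> _ _|va vb vA vB].
  + by rewrite adj; exact: cross_adj3.
  + by rewrite adj; exact: cross_adj4.
  + move: (X u A) (X (inr a) u) (X u (inr b)); rewrite DA.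
    by apply: crossR; rewrite ?neq ?sA ?sB //; left.
  + move: (X u B) (X (inr b) u) (X u (inr a)); rewrite DB.
    by apply: crossR; rewrite ?neq ?sA ?sB //; right.
  + exact: X.
Qed.

Definition surg : diagram n := exist _ surg_matching surg_matchingP.

Let mid (i : 'I_n) : stack_vertex n := inr i.
Let out u : stack_vertex n := inl u.
Let G := gen_diagram ab.
Let rel_st := stack_rel G D.

Lemma stack_lower u : rel_st (in_lower u) (in_lower (val D u)).
Proof. by apply/orP; left; apply/existsP; exists u; rewrite !eqxx. Qed.

Lemma stack_upper u : rel_st (in_upper u) (in_upper (val G u)).
Proof. by apply/orP; right; apply/existsP; exists u; rewrite !eqxx. Qed.

Lemma genE :
  [/\ val G (inl a) = inl b, val G (inl b) = inl a, val G (inr a) = inr b,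
      val G (inr b) = inr a & forall x, x != a -> x != b ->
        val G (inl x) = inr x /\ val G (inr x) = inl x].
Proof.
have ba : (b == a) = false by apply/eqP => e; move: ab; rewrite e; lia.
split; rewrite ?ffunE ?eqxx ?ba // => x /negPf xa /negPf xb.
by rewrite !ffunE xa xb.
Qed.

Lemma connect_lower u : u != inr a -> u != inr b ->
  connect rel_st (out u) (in_lower u) /\ connect rel_st (in_lower u) (out u).
Proof.
case: u => x xa xb; first by split; exact: connect0.
have [_ _ _ _ /(_ x) []] := genE.
- by apply: contraNneq xa => ->.
- by apply: contraNneq xb => ->.
move=> e1 e2; split; apply: connect1.
  by have := stack_upper (inr x); rewrite e2.
by have := stack_upper (inl x); rewrite e1.
Qed.

(** The generator joins the middle vertices a and b, and with them the strands
of [D] that end there; all other strands go straight through it. *)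
Lemma connect_surg u : connect rel_st (out u) (out (surg_matching u)).
Proof.
have [Ga Gb Ga' Gb' _] := genE; have [Ab Ba Aa Bb AB] := surg_facts.
have [Al lA] := connect_lower Aa Ab; have [Bl lB] := connect_lower Ba Bb.
have lAa : rel_st (in_lower A) (mid a).
  by have := stack_lower A; rewrite diagK.
have laA : rel_st (mid a) (in_lower A) by have := stack_lower (inr a).
have lBb : rel_st (in_lower B) (mid b).
  by have := stack_lower B; rewrite diagK.
have lbB : rel_st (mid b) (in_lower B) by have := stack_lower (inr b).
have mab : rel_st (mid a) (mid b) by have := stack_upper (inl a); rewrite Ga.
have mba : rel_st (mid b) (mid a) by have := stack_upper (inl b); rewrite Gb.
case: (surgP u) => [->|->|-> _ _|-> _ _|ua ub uA uB].
- by apply: connect1; have := stack_upper (inr a); rewrite Ga'.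
- by apply: connect1; have := stack_upper (inr b); rewrite Gb'.
- apply: connect_trans Al _; apply: connect_trans (connect1 lAa) _.
  apply: connect_trans (connect1 mab) _; apply: connect_trans (connect1 lbB) _.
  exact: lB.
- apply: connect_trans Bl _; apply: connect_trans (connect1 lBb) _.
  apply: connect_trans (connect1 mba) _; apply: connect_trans (connect1 laA) _.
  exact: lA.
apply: connect_trans (proj1 (connect_lower ua ub)) _.
apply: connect_trans (connect1 (stack_lower u)) _.
apply: (proj2 (connect_lower _ _)).
  by apply: contraNneq uA => e; rewrite /A -e diagK.
by apply: contraNneq uB => e; rewrite /B -e diagK.
Qed.

(* A strand of the stack, given by its two outer ends: an invariant of the
connected components that separates them. *)
Let strand (x : stack_vertex n) : {set vertex n} :=
  match x with
  | inl u => [set u; surg_matching u]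
  | inr i => if (i == a) || (i == b) then [set A; B]
             else [set inr i; surg_matching (inr i)]
  end.

Lemma surgK : involutive surg_matching.
Proof. exact: (diagK surg). Qed.

Lemma strand_lower u : strand (in_lower u) = strand (in_lower (val D u)).
Proof.
have [Ab Ba Aa Bb AB] := surg_facts; have [Ea Eb EA EB EO] := surgE.
have lowerE v : v != inr a -> v != inr b ->
    strand (in_lower v) = [set v; surg_matching v].
  case: v => x //= xa xb; case: eqP => [e|_]; first by rewrite e eqxx in xa.
  by case: eqP => [e|//]; rewrite e eqxx in xb.
have la : strand (in_lower (inr a)) = [set A; B] by rewrite /= eqxx.
have lb : strand (in_lower (inr b)) = [set A; B] by rewrite /= eqxx orbT.
have lA : strand (in_lower A) = [set A; B] by rewrite lowerE // EA.
have lB : strand (in_lower B) = [set A; B] by rewrite lowerE // EB setUC.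
case: (eqVneq u (inr a)) => [->|ua]; first by rewrite la lA.
case: (eqVneq u (inr b)) => [->|ub]; first by rewrite lb lB.
case: (eqVneq u A) => [->|uA]; first by rewrite lA {2}/A diagK la.
case: (eqVneq u B) => [->|uB]; first by rewrite lB {2}/B diagK lb.
have sA : val D u != inr a.
  by apply: contraNneq uA => e; rewrite /A -e diagK.
have sB : val D u != inr b.
  by apply: contraNneq uB => e; rewrite /B -e diagK.
rewrite !lowerE // -(EO u) // surgK setUC //.
Qed.

Lemma strand_upper u : strand (in_upper u) = strand (in_upper (val G u)).
Proof.
have [Ga Gb Ga' Gb' GO] := genE; have [Ea Eb EA EB EO] := surgE.
have eqc (x : 'I_n) : x = a \/ x = b \/ x != a /\ x != b.
  by case: (eqVneq x a); case: (eqVneq x b); auto.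
case: u => x; case: (eqc x) => [->|[->|[xa xb]]].
- by rewrite Ga /= eqxx orTb eqxx orbT.
- by rewrite Gb /= eqxx orbT eqxx.
- by have [-> _] := GO x xa xb; rewrite /= (negPf xa) (negPf xb).
- by rewrite Ga' /= Ea Eb setUC.
- by rewrite Gb' /= Ea Eb setUC.
- by have [_ ->] := GO x xa xb; rewrite /= (negPf xa) (negPf xb).
Qed.

Lemma strand_connect x y : connect rel_st x y -> strand x = strand y.
Proof.
case/connectP => p + ->; elim: p x => //= z p IHp x /andP[xz /IHp <-].
case/orP: xz => /existsP[u /andP[/eqP <- /eqP <-]].
  exact: strand_lower.
exact: strand_upper.
Qed.

Lemma is_stack_surg D'' : is_stack G D D'' = (D'' == surg).
Proof.
have key u v : (u != v) && connect rel_st (inl u) (inl v) = (surg_matching u == v).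
  apply/andP/eqP => [[uv /strand_connect /= e]|<-].
    have : v \in [set u; surg_matching u] by rewrite e set21.
    by rewrite !inE eq_sym (negPf uv) => /eqP.
  by split; [rewrite eq_sym (diag_neq surg)|exact: connect_surg].
apply/idP/eqP => [/forallP h|->].
  apply: val_inj; apply/ffunP => u.
  by have /forallP/(_ (val D'' u)) := h u; rewrite eqxx key => /eqP/esym/eqP.
by apply/forallP => u; apply/forallP => v; rewrite key.
Qed.

(** The hypothesis that a and b are not linked in [D] excludes the only possible
loop. *)
Lemma nloops_surg : nloops G D = 0.
Proof.
have [Ab Ba Aa Bb AB] := surg_facts.
have [Ga Gb Ga' Gb' GO] := genE.
have toout x : exists u, connect rel_st x (inl u).
  have lower u : u != inr a -> u != inr b ->
      exists v, connect rel_st (in_lower u) (inl v).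
    by move=> ua ub; exists u; case: (connect_lower ua ub).
  case: x => [u|i]; first by exists u; exact: connect0.
  case: (eqVneq i a) => [->|ia].
    have [v cv] := lower A Aa Ab; exists v; apply: connect_trans cv.
    by apply: connect1; have := stack_lower (inr a).
  case: (eqVneq i b) => [->|ib].
    have [v cv] := lower B Ba Bb; exists v; apply: connect_trans cv.
    by apply: connect1; have := stack_lower (inr b).
  apply: (lower (inr i)); first by apply: contraNneq ia => -[->].
  by apply: contraNneq ib => -[->].
apply: eq_card0 => x; rewrite !inE; apply/negP => /andP[_ /forallP h].
by have [u cu] := toout x; have := h u; rewrite cu.
Qed.

Section Labels.
Variable k : nat.
Hypotheses (kn : k <= n) (Dk : in_ind_basis k D).
Hypotheses (ca : ~~ closes k D (inr a)) (cb : closes k D (inr b)).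

Lemma surg_in_ind_basis : in_ind_basis k surg.
Proof.
have clA : closes k D A by rewrite closes_diag.
have clB : ~~ closes k D B by rewrite closes_diag // negbK.
apply/forallP => i; apply/forallP => j; apply/implyP => /eqP /=.
have bt x : closes k D (inl x) = (x < k) by exact: closes_bottom.
case: surgP => //.
- move=> eA _ _ eB; move: clA clB; rewrite -eA eB !bt; lia.
- move=> eA _ _ eB; move: clA clB; rewrite -eA eB !bt; lia.
move=> _ _ _ _ e; have /forallP/(_ i)/forallP/(_ j) := Dk.
by rewrite e eqxx.
Qed.

(** The new link between the partners A and B does not alter which of them
closes: in the rotated order B comes before b, which is followed by a, which
comes before A. *)
Lemma closes_surg j :
  closes k surg (inr j) = closes k D (inr (tperm a b j)).
Proof.
have [Ea Eb EA EB EO] := surgE.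
have clA : closes k D A by rewrite closes_diag.
have clB : ~~ closes k D B by rewrite closes_diag // negbK.
have rab : rpos k (inr a : vertex n) = (rpos k (inr b : vertex n)).+1.
  rewrite /rpos /= ab; have := ltn_ord a; have := ltn_ord b; rewrite ab.
  by case: (ltnP (2 * n - a.+1) k); case: (ltnP (2 * n - a.+2) k); lia.
have rBA : rpos k B < rpos k A.
  move: clA clB; rewrite /closes {1}/A {2}/B !diagK rab -leqNgt.
  have /eqP : rpos k B <> rpos k (inr b).
    by move/(rpos_inj kn)/eqP; apply/negP; exact: diag_neq.
  by move: (rpos k A) (rpos k B) (rpos k _); lia.
case: tpermP => [->|->|/eqP ja /eqP jb].
- by rewrite cb (@closes_top _ _ surg _ _ kn Ea) ab ltnSn.
- by rewrite (negPf ca) (@closes_top _ _ surg _ _ kn Eb) ab; lia.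
have ja' : inr j != inr a :> vertex n by apply: contraNneq ja => -[->].
have jb' : inr j != inr b :> vertex n by apply: contraNneq jb => -[->].
case: (eqVneq (inr j) A) => [->|jA]; first by rewrite clA /closes /= EA.
case: (eqVneq (inr j) B) => [->|jB].
  by rewrite (negPf clB) /closes /= EB; apply/negbTE; rewrite -leqNgt ltnW.
by rewrite /closes /= EO.
Qed.

End Labels.
End Surgery.

(** * The diagram of a label *)

Section LabelDiagram.
Variables (n : nat) (D : diagram n) (k : nat).
Hypotheses (kn : k <= n) (Dk : in_ind_basis k D).

Let t := rev_tuple (lab k D).

Let tE x : tnth t x = closes k D (inr x).
Proof. by rewrite tnth_rev_tuple tnth_lab. Qed.

Let nminus_t : nminus t = k.
Proof. by rewrite /nminus count_rev; exact: nminus_lab. Qed.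

(* The state of the construction after it has processed the positions in r:
the stack consists of the signs - whose partner is not in r. *)
Let pending (r : seq 'I_n) :=
  [seq y <- r | ~~ tnth t y & [forall x, (x \in r) ==> (val D (inr y) != inr x)]].

Let links_of (r : seq 'I_n) (L : seq ('I_n * 'I_n)) :=
  uniq L /\ forall x y, ((x, y) \in L) =
    [&& x \in r, y \in r, tnth t x & val D (inr x) == inr y].

Lemma opener_partner x y : tnth t x -> val D (inr x) = inr y ->
  x < y /\ ~~ tnth t y.
Proof.
rewrite tE => tx e; split; first by rewrite -(closes_top kn e).
by rewrite tE -e closes_diag // tx.
Qed.

Lemma rpos_top x : rpos k (inr x : vertex n) = 2 * n - x.+1 - k.
Proof.
by rewrite /rpos /=; have := ltn_ord x; case: (ltnP (2 * n - x.+1) k); lia.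
Qed.

(** The head of the stack is the nearest pending sign -. A sign + linked to
anything else would cross the link of that sign. *)
Lemma top_step_correct (a : 'I_n) (r : seq 'I_n) L U :
  path (fun x y : 'I_n => x < y) a r ->
  (forall x : 'I_n, (a < x) = (x \in r)) ->
  links_of r L -> U = pending r ->
  let: (L', U') := top_step t a (L, U) in
  links_of (a :: r) L' /\ U' = pending (a :: r).
Proof.
move=> ar rE [Lu LE] UE.
have anr : a \notin r by rewrite -rE ltnn.
have symD x y : val D (inr x) = inr y -> val D (inr y) = inr x.
  by move=> <-; rewrite diagK.
rewrite /top_step; case ta: (tnth t a); last first.
  split.
    split=> // x y; rewrite LE !inE.
    case: (eqVneq x a) => [->|xa]; first by rewrite ta (negPf anr) !andbF.
    case: (eqVneq y a) => [->|ya]; last by [].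
    rewrite (negPf anr) andbF /=; case: eqP => [e|]; last by rewrite !andbF.
    case tx: (tnth t x); last by rewrite !andbF.
    by have [] := opener_partner tx e; rewrite -(rE x); lia.
  rewrite /pending /= ta /=.
  have -> : [forall x, (x \in a :: r) ==> (val D (inr a) != inr x)].
    apply/forallP => x; apply/implyP; rewrite inE => xr; apply/eqP => e.
    have : ~~ (a < x) by rewrite -(closes_top kn e) -tE ta.
    case/orP: xr => [/eqP xa|]; last by rewrite -rE => ->.
    by have := diag_neq D (inr a); rewrite e xa eqxx.
  congr (_ :: _); rewrite UE; apply: eq_in_filter => y yr.
  case ty: (tnth t y) => //=; apply: eq_forallb => x; rewrite inE.
  case: (eqVneq x a) => //= ->; rewrite (negPf anr) /=.
  apply/esym/negP => /eqP/symD e.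
  move: yr; rewrite -rE -(closes_top kn e) -tE ta //.
have srt : sorted (fun x y : 'I_n => x < y) (pending r).
  apply: sorted_filter; first by move=> x y z; apply: ltn_trans.
  exact: path_sorted ar.
have pend y : (y \in pending r) =
    [&& y \in r, ~~ tnth t y & [forall x, (x \in r) ==> (val D (inr y) != inr x)]].
  by rewrite mem_filter andbC.
have a_pending y : val D (inr a) = inr y -> y \in pending r.
  move=> e; have [ay ty] := opener_partner ta e; rewrite pend -rE ay ty /=.
  apply/forallP => x; apply/implyP => xr; rewrite (symD _ _ e).
  by apply: contraNneq anr => -[->].
case: U UE => [|b U'] UE.
  have na y : val D (inr a) <> inr y.
    by move/a_pending; rewrite -UE.
  split.
    split=> // x y; rewrite LE !inE.
    case: (eqVneq x a) => [->|xa].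
      rewrite (negPf anr) /=; case: (eqVneq (val D (inr a)) (inr y)) => [e|_].
        by case: (na _ e).
      by rewrite !andbF.
    case: (eqVneq y a) => [->|ya]; last by [].
    rewrite (negPf anr) /= andbF; case: (eqVneq (val D (inr x)) (inr a)) => [e|_].
      by case: (na _ (symD _ _ e)).
    by rewrite !andbF.
  rewrite /pending /= ta /=; apply/esym/eqP; rewrite -[_ == _]negbK -has_filter.
  apply/hasPn => y yr; apply/negP => /andP[ty /forallP h].
  have : y \in pending r.
    rewrite pend yr ty; apply/forallP => x; apply/implyP => xr.
    by have := h x; rewrite inE xr orbT.
  by rewrite -UE.
have bp : b \in pending r by rewrite -UE mem_head.
move: (bp); rewrite pend => /and3P[br tb /forallP bo].
have ab : a < b by rewrite rE.
have bU' : all (fun y : 'I_n => b < y) U'.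
  rewrite -UE /= in srt; apply: order_path_min srt.
  by move=> x y z; apply: ltn_trans.
have Dab : val D (inr a) = inr b.
  apply/eqP; apply: contraT => Nab.
  have pb : rpos k (val D (inr a)) < rpos k (inr b).
    case e : (val D (inr a)) => [i|y]; rewrite rpos_top.
      move: ta; rewrite tE (closes_through kn e) => ki.
      rewrite /rpos /= (ltnNge i k) ki /=.
      by have := ltn_ord i; have := ltn_ord b; clear -kn ki; lia.
    have := a_pending _ e; rewrite -UE inE => /orP[/eqP yb|yU].
      by rewrite e yb eqxx in Nab.
    by rewrite rpos_top; have := allP bU' _ yU; have := ltn_ord y; clear -kn; lia.
  have qa : rpos k (inr a) < rpos k (val D (inr b)).
    have := closes_diag D (inr b) kn; rewrite -tE tb.
    case e : (val D (inr b)) => [i|z] /=; rewrite rpos_top.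
      rewrite closes_bottom // => ik.
      by rewrite /rpos /= ik; have := ltn_ord i; have := ltn_ord a; clear -kn; lia.
    move=> _; rewrite rpos_top.
    have za : ~~ (a < z).
      by rewrite rE; apply: contraL (bo z) => zr; rewrite zr e eqxx.
    have Nza : z != a.
      by apply: contraNneq Nab => za'; rewrite -za' -e diagK.
    by move: Nza za; rewrite -val_eqE /=; have := ltn_ord a; clear -kn; lia.
  have := rpos_noncross D (val D (inr a)) (inr b) kn; rewrite diagK pb qa andbT /=.
  by rewrite !rpos_top; have := ltn_ord b; clear -kn ab; lia.
split.
  split=> [|x y]; first by rewrite /= LE (negPf anr) Lu.
  rewrite !inE LE xpair_eqE; case: (eqVneq x a) => [->|xa] /=.
    rewrite (negPf anr) /= orbF ta Dab.
    case: (eqVneq y b) => [->|yb]; first by rewrite br eqxx orbT.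
    case: (eqVneq (inr b : vertex n) (inr y)) => [[e]|_]; last by rewrite !andbF.
    by rewrite e eqxx in yb.
  case: (eqVneq y a) => [->|ya] //=; rewrite (negPf anr) andbF /=.
  case: (eqVneq (val D (inr x)) (inr a)) => [e|_]; last by rewrite !andbF.
  suff -> : x = b by rewrite (negPf tb) !andbF.
  by apply/eqP; have := symD _ _ e; rewrite Dab => -[->].
have bNU : b \notin U' by apply/negP => /(allP bU'); rewrite ltnn.
have -> : U' = [seq y <- pending r | y != b].
  rewrite -UE /= eqxx /=; apply/esym/all_filterP/allP => y yU.
  by apply: contraNneq bNU => <-.
rewrite /pending /= ta /= -filter_predI; apply: eq_in_filter => y yr /=.
rewrite andbCA; case: (tnth t y) => //=.
apply/andP/forallP => [[yb /forallP h] x|h].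
  rewrite inE; case: (eqVneq x a) => [->|_] /=; last exact: h.
  by apply: contraNneq yb => /symD; rewrite Dab => -[->].
split; last first.
  by apply/forallP => x; apply/implyP => xr; have := h x; rewrite inE xr orbT.
by apply: contraTneq (h a) => ->; rewrite inE eqxx -Dab diagK eqxx.
Qed.

Lemma top_links_correct : links_of (enum 'I_n) (top_links t).
Proof.
rewrite /top_links.
suff h (m : nat) (r : seq 'I_n) : drop m (enum 'I_n) = r ->
    links_of r (foldr (top_step t) ([::], [::]) r).1 /\
    (foldr (top_step t) ([::], [::]) r).2 = pending r.
  by have [] := h 0 _ (drop0 _).
elim: r m => [|a r IHr] m e; first by split=> //; split.
have mn : m < n.
  rewrite ltnNge; apply/negP => nm; move: e; rewrite drop_oversize //.
  by rewrite size_enum_ord.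
move: e; rewrite (drop_nth a) ?size_enum_ord // => -[am re].
have aE : a = m :> nat by rewrite -am nth_enum_ord.
have [IL IU] := IHr _ re.
move: IL IU => /=; case: (foldr _ _ r) => L U /= IL IU.
have rE (x : 'I_n) : (a < x) = (x \in r).
  have : uniq (enum 'I_n) := enum_uniq _.
  have : x \in take m.+1 (enum 'I_n) ++ r by rewrite -re cat_take_drop mem_enum.
  rewrite -{2}(cat_take_drop m.+1 (enum 'I_n)) re cat_uniq mem_cat.
  move=> xin /and3P[_ dis _].
  have xt : (x \in take m.+1 (enum 'I_n)) = (x <= a).
    rewrite aE -ltnS in_take ?mem_enum // index_enum_ord //.
  have := hasPn dis x; rewrite xt; move: xin; rewrite xt.
  by rewrite ltnNge; case: (x <= a); case: (x \in r) => //= _ /(_ isT).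
have ar : path (fun x y : 'I_n => x < y) a r.
  rewrite path_min_sorted; last by apply/allP => x; rewrite rE.
  rewrite -re; apply: drop_sorted.
  have := iota_ltn_sorted 0 n; rewrite -val_enum_ord sorted_map.
  by [].
have := top_step_correct ar rE IL IU; rewrite /top_step.
by case: (tnth t a) => //; case: U {IU}.
Qed.

Lemma top_linkE x y : top_link t x y = (val D (inr x) == inr y).
Proof.
have [_ LE] := top_links_correct; rewrite /top_link !LE !mem_enum /=.
have symD : (val D (inr y) == inr x) = (val D (inr x) == inr y).
  by apply/eqP/eqP => <-; rewrite diagK.
rewrite symD -andb_orl; case: eqP => [e|]; last by rewrite andbF.
by rewrite andbT !tE -e closes_diag // orbN.
Qed.

Let is_top (u : vertex n) := if u is inr _ then true else false.

Lemma size_top_links :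
  size (top_links t) = \sum_(x < n) (tnth t x && is_top (val D (inr x))).
Proof.
have [Lu LE] := top_links_correct.
rewrite -(size_map fst) -big_mkcond sum1_card /=.
have fu : uniq [seq p.1 | p <- top_links t].
  rewrite map_inj_in_uniq // => -[x y] [x' y']; rewrite !LE /= => h h' e.
  move: h h'; rewrite -e => /and4P[_ _ _ /eqP ->] /and4P[_ _ _ /eqP [->]].
  by [].
rewrite -(card_uniqP fu); apply: eq_card => x; rewrite [RHS]unfold_in /=.
apply/mapP/andP => [[[x' y] + /= ->]|[tx]].
  by rewrite LE => /and4P[_ _ -> /eqP ->].
case e : (val D (inr x)) => [//|y] _; exists (x, y) => //.
by rewrite LE !mem_enum tx e eqxx.
Qed.

(** The n - k bottom vertices from k on open, the n - k signs + of the label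
close, and as many of the former as of the latter belong to links between the
two lines. *)
Lemma sum_bottom_links :
  \sum_(y < n) ((k <= y) && ~~ is_top (val D (inl y))) = size (top_links t).
Proof.
pose f u := [&& ~~ is_top u, is_top (val D u) & ~~ closes k D u] : nat.
have fS : \sum_u f u = \sum_(y < n) ((k <= y) && is_top (val D (inl y))).
  rewrite big_sumType /= [X in _ + X]big1 // addn0; apply: eq_bigr => y _.
  by rewrite /f /= closes_bottom // -leqNgt andbC.
have fS' : \sum_u f u = \sum_(x < n) (tnth t x && ~~ is_top (val D (inr x))).
  rewrite (reindex_inj (@diag_inj n D)) big_sumType /= [X in X + _]big1 => [|y _].
    apply: eq_bigr => x _.
    by rewrite /f diagK closes_diag // negbK tE /= andbC.
  by rewrite /f diagK andbF.
have s1 : \sum_(y < n) (k <= y) = n - k.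
  rewrite -(card_ord_itv k (leqnn n)) -sum1_card [RHS]big_mkcond /=.
  by apply: eq_bigr => y _; rewrite inE ltn_ord andbT; case: leqP.
have s2 : \sum_(x < n) tnth t x = n - k.
  have -> : \sum_(x < n) tnth t x = count id t.
    rewrite -sum1_count big_tuple [RHS]big_mkcond.
    by apply: eq_bigr => x _; case: (tnth t x).
  rewrite -(nminus_t) /nminus -[X in _ = X - _](size_tuple t).
  by rewrite -(count_predC id t) addnK.
have split_sum (P Q : pred 'I_n) :
    \sum_x (P x : nat) = \sum_x (P x && Q x) + \sum_x (P x && ~~ Q x).
  by rewrite -big_split; apply: eq_bigr => x _; case: (P x); case: (Q x).
have := split_sum (fun y => k <= y) (fun y => is_top (val D (inl y))).
have := split_sum (fun x => tnth t x) (fun x => is_top (val D (inr x))).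
rewrite s1 s2 -fS -fS' -size_top_links => e1 e2.
by apply: (@addnI (\sum_u f u)); rewrite -e2 e1 addnC.
Qed.

(** Nothing inside a link between bottom vertices can reach the top line. *)
Lemma bottom_inside (x y z : 'I_n) : val D (inl x) = inl y -> x < z < y ->
  exists2 w, val D (inl z) = inl w & x < w < y.
Proof.
move=> e /andP[xz zy].
have X1 := diag_noncross D (inl x) (inl z).
have X2 := diag_noncross D (val D (inl z)) (inl x).
have ye : val D (inl y) = inl x by rewrite -e diagK.
case ez : (val D (inl z)) X1 X2 => [w|w]; rewrite -ez diagK ez e /=.
  move=> X1 X2; exists w => //.
  have wx : w != x.
    by apply: contraTneq zy => wx; move: e; rewrite -wx -ez diagK => -[->]; rewrite ltnn.
  have wy : w != y.
    by apply: contraTneq xz => wy; move: ye; rewrite -wy -ez diagK => -[->]; rewrite ltnn.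
  by move: wx wy X1 X2; rewrite -!val_eqE /=; clear -xz zy; lia.
by have := ltn_ord w; have := ltn_ord y; clear -xz zy; lia.
Qed.

Lemma basis_bottom (x y : 'I_n) : val D (inl x) = inl y -> (x < k) = (k <= y).
Proof.
move=> e; rewrite [RHS]leqNgt -(closes_bottom y kn Dk) -(closes_bottom x kn Dk).
by rewrite -e closes_diag // negbK.
Qed.

(** A bottom link joins the two sides of the gap between k-1 and k. A vertex
between two successive such links would have to be linked across one of them. *)
Lemma bottom_nested (x y : 'I_n) :
  k <= y -> val D (inl y) = inl x -> x + y.+1 = 2 * k.
Proof.
have [m] := ubnP (nat_of_ord y); elim: m x y => // m IHm x y ym ky e.
have e' : val D (inl x) = inl y by rewrite -e diagK.
have xk : x < k by rewrite (basis_bottom e').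
have next (z : 'I_n) : z = x.+1 :> nat -> z < k ->
    exists w, [/\ val D (inl z) = inl w, k <= w & w < y].
  move=> zx zk; have [|w ew /andP[_ wy]] := @bottom_inside x y z e'; first by lia.
  by exists w; split=> //; rewrite -(basis_bottom ew).
have zn : x.+1 < n \/ x.+1 = n by have := ltn_ord x; lia.
have [yk|yk] := eqVneq (nat_of_ord y) k.
  suff : ~ (x.+1 < k) by lia.
  move=> zk; have zn' : x.+1 < n by lia.
  by have [//|w [_ kw wy]] := next (Ordinal zn') erefl; lia.
have ypn : y.-1 < n by have := ltn_ord y; lia.
pose y' := Ordinal ypn.
have [|x' ex' /andP[xx' x'y]] := @bottom_inside x y y' e'; first by rewrite /=; lia.
have y'm : y' < m by rewrite /=; lia.
have ky' : k <= y' by rewrite /=; lia.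
have := IHm x' y' y'm ky' ex'; rewrite /= => h.
suff : ~ (x.+1 < x') by lia.
move=> zx'; have zn' : x.+1 < n by have := ltn_ord x'; lia.
have [|w [ew kw wy]] := next (Ordinal zn') erefl; first by rewrite /=; lia.
have ey' : val D (inl x') = inl y' by rewrite -ex' diagK.
have := diag_noncross D (inl (Ordinal zn')) (inl x'); rewrite ew ey' /=.
have : w != y'.
  by apply: contraTneq zx' => wy'; move: ew; rewrite wy' => /(congr1 (val D));
    rewrite ex' diagK => -[<-] /=; rewrite ltnn.
by rewrite -val_eqE /=; lia.
Qed.

(** The vertices y from k on with a bottom link form an initial segment, as the
links are nested; its length is the number of links. *)
Lemma bottom_linked (y : 'I_n) : k <= y ->
  ~~ is_top (val D (inl y)) = (y < k + size (top_links t)).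
Proof.
move=> ky; rewrite -sum_bottom_links.
pose B (y : 'I_n) := (k <= y) && ~~ is_top (val D (inl y)).
have -> : \sum_(y < n) ((k <= y) && ~~ is_top (val D (inl y))) = #|[pred y | B y]|.
  rewrite -sum1_card [RHS]big_mkcond; apply: eq_bigr => z _.
  by rewrite inE /B; case: (_ && _).
apply/idP/idP => [yB|].
  suff : #|[pred z : 'I_n | k <= z < y.+1]| <= #|[pred y | B y]|.
    by rewrite card_ord_itv ?ltn_ord //; lia.
  apply/subset_leq_card/subsetP => z; rewrite !inE => /andP[kz zy]; rewrite /B kz /=.
  case e : (val D (inl y)) yB => [x|//] _.
  have e' : val D (inl x) = inl y by rewrite -e diagK.
  have xk : x < k by rewrite (basis_bottom e').
  case: (eqVneq z y) => [->|Nzy]; first by rewrite e.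
  have [|w -> _] // := @bottom_inside x y z e'.
  by move: Nzy; rewrite -val_eqE /=; lia.
apply: contraTT => /negPn yT; rewrite -leqNgt.
suff : #|[pred y | B y]| <= #|[pred z : 'I_n | k <= z < y]|.
  by rewrite card_ord_itv ?(ltnW (ltn_ord y)) //; lia.
apply/subset_leq_card/subsetP => z; rewrite !inE /B => /andP[kz zB].
rewrite kz /= ltnNge; apply/negP => yz.
case e : (val D (inl z)) zB => [x|//] _.
have e' : val D (inl x) = inl z by rewrite -e diagK.
have xk : x < k by rewrite (basis_bottom e').
case: (eqVneq z y) => [zy|Nzy]; first by move: yT; rewrite -zy e.
have [|w ew _] := @bottom_inside x z y e'; last by rewrite ew in yT.
by move: Nzy; rewrite -val_eqE /=; lia.
Qed.

Lemma bottom_arcE (x y : 'I_n) :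
  bottom_arc t x y = (k <= y) && (val D (inl y) == inl x).
Proof.
rewrite /bottom_arc nminus_t; apply/existsP/andP => [[i /andP[/eqP xi /eqP yi]]|].
  have ky : k <= y by lia.
  split=> //; have := bottom_linked ky.
  have -> : y < k + size (top_links t) by have := ltn_ord i; lia.
  case e : (val D (inl y)) => [x'|//] _; have := bottom_nested ky e => h.
  by apply/eqP; congr inl; apply: val_inj => /=; lia.
case=> ky /eqP e; have := bottom_linked ky; rewrite e /= => /esym yp.
have ip : y - k < size (top_links t) by lia.
exists (Ordinal ip) => /=; have := bottom_nested ky e.
by have := ltn_ord x; move=> ? ?; apply/andP; split; apply/eqP; lia.
Qed.

Lemma bottom_linkE x y : bottom_link t x y = (val D (inl x) == inl y).
Proof.
rewrite /bottom_link !bottom_arcE.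
have symD : (val D (inl y) == inl x) = (val D (inl x) == inl y).
  by apply/eqP/eqP => <-; rewrite diagK.
rewrite symD -andb_orl; case: eqP => [e|]; last by rewrite andbF.
by rewrite andbT -(basis_bottom e); case: ltnP.
Qed.

Lemma free_topE : free_top t = [seq x <- enum 'I_n | ~~ is_top (val D (inr x))].
Proof.
apply: eq_filter => x; congr (~~ _); apply/existsP/idP => [[y]|].
  by rewrite top_linkE => /eqP ->.
by case e : (val D (inr x)) => [//|y] _; exists y; rewrite top_linkE e.
Qed.

Lemma free_bottomE :
  free_bottom t = [seq x <- enum 'I_n | is_top (val D (inl x))].
Proof.
apply: eq_filter => x; rewrite -[RHS]negbK; congr (~~ _).
apply/existsP/idP => [[y]|].
  by rewrite bottom_linkE => /eqP ->.
by case e : (val D (inl x)) => [y|//] _; exists y; rewrite bottom_linkE e.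
Qed.

Let through x := if val D (inl x) is inr y then y else x.

(** Links between the two lines do not cross, so they are increasing. *)
Lemma map_through : [seq through x | x <- free_bottom t] = free_top t.
Proof.
have srt (P : pred 'I_n) : sorted (fun x y : 'I_n => x < y) (filter P (enum 'I_n)).
  apply: sorted_filter; first by move=> x y z; apply: ltn_trans.
  by have := iota_ltn_sorted 0 n; rewrite -val_enum_ord sorted_map.
rewrite free_topE free_bottomE.
apply: (@irr_sorted_eq _ (fun x y : 'I_n => x < y)) => //.
- by move=> x y z; apply: ltn_trans.
- by move=> x; rewrite ltnn.
- apply: (homo_sorted_in _ (filter_all _ _) (srt _)) => x y /=.
  rewrite !unfold_in /= /through.
  case ex : (val D (inl x)) => [//|x'] _; case ey : (val D (inl y)) => [//|y'] _ xy.
  have := diag_noncross D (inl x) (inl y); rewrite ex ey /=.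
  have : x' != y'.
    apply: contraTneq xy => e; move: ex; rewrite e -ey => /diag_inj[->].
    by rewrite ltnn.
  rewrite -val_eqE /=; have := ltn_ord x; have := ltn_ord y.
  have := ltn_ord x'; have := ltn_ord y'; lia.
move=> y; rewrite mem_filter mem_enum andbT; apply/mapP/idP => [[x]|].
  rewrite mem_filter mem_enum andbT /through.
  by case ex : (val D (inl x)) => [//|x'] _ ->; rewrite -ex diagK.
case ey : (val D (inr y)) => [x|//] _; have ex : val D (inl x) = inr y.
  by rewrite -ey diagK.
exists x; last by rewrite /through ex.
by rewrite mem_filter mem_enum ex.
Qed.

Lemma through_linkE x y : through_link t x y = (val D (inl x) == inr y).
Proof.
have mt := map_through; have ut : uniq (free_top t) by rewrite filter_uniq ?enum_uniq.
have ub : uniq (free_bottom t) by rewrite filter_uniq ?enum_uniq.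
have sz : size (free_top t) = size (free_bottom t) by rewrite -mt size_map.
have nthE z : z \in free_bottom t ->
    nth (through z) (free_top t) (index z (free_bottom t)) = through z.
  move=> zb; rewrite -mt (nth_map z) ?index_mem // nth_index //.
apply/and3P/eqP => [[xb yt /eqP xy]|e].
  have := nthE x xb; rewrite xy nth_index // => ->.
  move: xb; rewrite free_bottomE mem_filter /through.
  by case: (val D (inl x)).
have xb : x \in free_bottom t by rewrite free_bottomE mem_filter e mem_enum.
have thx : through x = y by rewrite /through e.
have := nthE x xb; rewrite thx => yE.
have yt : y \in free_top t by rewrite -mt -thx map_f.
split=> //; rewrite -[X in _ == index X _]yE index_uniq //.
by rewrite sz index_mem.
Qed.

Lemma label_linkE u v : label_link t u v = (val D u == v).
Proof.
case: u v => x [] y /=.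
- exact: bottom_linkE.
- exact: through_linkE.
- by rewrite through_linkE; apply/eqP/eqP => <-; rewrite diagK.
- exact: top_linkE.
Qed.

Lemma label_diagram_lab : label_diagram t = val D.
Proof.
apply/ffunP => u; rewrite ffunE; case: pickP => [v|/(_ (val D u))] /=.
  by rewrite label_linkE => /eqP.
by rewrite label_linkE eqxx.
Qed.

End LabelDiagram.

Import Order.TTheory GRing.Theory Num.Theory.
Local Open Scope ring_scope.

(** * Polynomials in the inverse of q *)

Local Notation "x %:F" := (@FracField.tofrac _ x).

Section Integrality.
Variable R : realType.
Local Notation K := (Kq R).
Local Notation q := (q R).

Definition evZ (p : {poly int}) : K := (map_poly intr p).[q^-1].

Definition in_ZqV (x : K) := exists p, x = evZ p.

Lemma in_ZqV1 : in_ZqV 1.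
Proof. by exists 1; rewrite /evZ rmorph1 hornerC. Qed.

Lemma in_ZqVM x y : in_ZqV x -> in_ZqV y -> in_ZqV (x * y).
Proof. by case=> p -> [r ->]; exists (p * r); rewrite /evZ rmorphM hornerM. Qed.

Lemma in_ZqV_nat m : in_ZqV m%:R.
Proof. by exists (m%:R)%:P; rewrite /evZ map_polyC hornerC /= rmorph_nat. Qed.

Lemma in_ZqVD x y : in_ZqV x -> in_ZqV y -> in_ZqV (x + y).
Proof. by case=> p -> [r ->]; exists (p + r); rewrite /evZ rmorphD hornerD. Qed.

Lemma in_ZqVN x : in_ZqV x -> in_ZqV (- x).
Proof. by case=> p ->; exists (- p); rewrite /evZ rmorphN hornerN. Qed.

Lemma in_qVZqV_Z x : in_qVZqV x -> in_ZqV x.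
Proof.
case=> p ->; exists ('X * p).
by rewrite /evZ rmorphM /= map_polyX hornerM hornerX.
Qed.

Lemma in_qVZqV_qV : in_qVZqV (q^-1 : K).
Proof. by exists 1; rewrite rmorph1 hornerC mulr1. Qed.

Lemma in_qVZqV0 : in_qVZqV (0 : K).
Proof. by exists 0; rewrite rmorph0 horner0 mulr0. Qed.

Lemma in_qVZqVD (x y : K) : in_qVZqV x -> in_qVZqV y -> in_qVZqV (x + y).
Proof.
by case=> p -> [r ->]; exists (p + r); rewrite rmorphD hornerD mulrDr.
Qed.

Lemma in_qVZqVMr (x y : K) : in_qVZqV x -> in_ZqV y -> in_qVZqV (x * y).
Proof.
by case=> p -> [r ->]; exists (p * r); rewrite rmorphM hornerM mulrA.
Qed.

Lemma in_qVZqVN (x : K) : in_qVZqV x -> in_qVZqV (- x).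
Proof. by case=> p ->; exists (- p); rewrite rmorphN hornerN mulrN. Qed.

Lemma in_qVZqV_sum I (r : seq I) (P : pred I) (F : I -> K) :
  (forall i, P i -> in_qVZqV (F i)) -> in_qVZqV (\sum_(i <- r | P i) F i).
Proof.
by move=> h; apply: (big_ind (@in_qVZqV R)) => //; [exact: in_qVZqV0|exact: in_qVZqVD].
Qed.

Lemma tofrac_horner (f : {poly R[i]}) : f%:F = (map_poly (@scal R) f).[q].
Proof.
rewrite -{1}[f]comp_polyXr /comp_poly -horner_map /= -map_poly_comp.
by [].
Qed.

(** Without constant term, one side has only positive powers of q and the other
one only negative powers. *)
Lemma eval_qV_fixed (f : {poly R[i]}) :
  f`_0 = 0 -> eval_qV f = f%:F -> f = 0.
Proof.
move=> f0 fE; apply/eqP; apply: contraT => fn0.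
set m := size f.
have m1 : (1 < m)%N.
  rewrite ltnNge; apply/negP => /size1_polyC fc.
  by move: fn0; rewrite fc f0 polyC0 eqxx.
have: (\poly_(i < m) f`_(m.-1 - i))%:F = q ^+ m.-1 * eval_qV f :> K.
  rewrite /eval_qV (@horner_coef_wide _ m); last by rewrite size_map_poly.
  rewrite poly_def rmorph_sum mulr_sumr (reindex_inj rev_ord_inj) /=.
  apply: eq_bigr => i _; rewrite coef_map /= -mul_polyC rmorphM rmorphXn /=.
  rewrite -/(scal _) -/q mulrCA; congr (scal f`_ _ * _).
    by have := ltn_ord i; rewrite -/m; lia.
  have -> : (m - i.+1 = m.-1 - i)%N by lia.
  rewrite exprVn -exprB ?unitfE ?q_neq0 //.
  by have := ltn_ord i; rewrite -/m; lia.
have -> : q ^+ m.-1 * eval_qV f = ('X^(m.-1) * f)%:F by rewrite fE rmorphM rmorphXn.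
move=> /eqP; rewrite tofrac_eq => /eqP/(congr1 (fun p : {poly R[i]} => size p)).
rewrite size_monicM ?monicXn // size_polyXn => e.
have := size_poly m (fun i => f`_(m.-1 - i)); rewrite e -/m.
by move: m1; clear; lia.
Qed.

Lemma bar_fixed_qVZqV (x : K) : in_qVZqV x -> bar x = x -> x = 0.
Proof.
case=> p ->; pose f : {poly R[i]} := 'X * map_poly intr p.
have scalE : map_poly (@scal R) (map_poly intr p) = map_poly intr p :> {poly K}.
  by rewrite -map_poly_comp; apply: eq_map_poly => z /=; rewrite rmorph_int.
have -> : q^-1 * (map_poly intr p).[q^-1] = eval_qV f.
  by rewrite /eval_qV /f rmorphM /= map_polyX scalE hornerM hornerX.
have barE : bar (eval_qV f) = f%:F.
  rewrite tofrac_horner /eval_qV -horner_map /= fmorphV /= bar_q invrK.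
  congr (_.[q]); rewrite -map_poly_comp; apply: eq_map_poly => z /=.
  exact: bar_scal.
move=> fE; rewrite barE in fE.
rewrite (@eval_qV_fixed f) ?rmorph0 ?fE //.
by rewrite /f mulrC coefMX.
Qed.

End Integrality.

(** * Operators and the last tensor factor *)

Section Slices.
Variable R : realType.
Local Notation K := (Kq R).
Local Notation q := (q R).
Local Notation Vn := (Vn R).

Lemma tuple_rconsP m (t : m.+1.-tuple bool) :
  exists s : m.-tuple bool, exists b, t = rcons_tuple s b.
Proof.
exists [tuple tnth t (widen_ord (leqnSn m) i) | i < m], (tnth t ord_max).
apply: eq_from_tnth => i.
rewrite [RHS](tnth_nth true) /= nth_rcons size_tuple ?card_ord.
case: (ltnP i m) => im.
  rewrite (nth_mktuple _ true (Ordinal im)).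
  by congr (tnth _ _); apply: val_inj.
have e : i = ord_max by apply: val_inj => /=; have := ltn_ord i; lia.
by rewrite e eqxx.
Qed.

Lemma tnth_rcons_widen m (s : m.-tuple bool) b (i : 'I_m) (j : 'I_m.+1) :
  j = i :> nat -> tnth (rcons_tuple s b) j = tnth s i.
Proof.
by move=> ji; rewrite !(tnth_nth true) /= nth_rcons size_tuple ji ltn_ord.
Qed.

Lemma tnth_rcons_max m (s : m.-tuple bool) b (j : 'I_m.+1) :
  j = m :> nat -> tnth (rcons_tuple s b) j = b.
Proof.
by move=> ji; rewrite (tnth_nth true) /= nth_rcons size_tuple ji ltnn eqxx.
Qed.

Lemma addVE n (x y : Vn n) t : (x + y) t = x t + y t.
Proof. by rewrite ffunE. Qed.

Lemma oppVE n (x : Vn n) t : (- x) t = - x t.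
Proof. by rewrite ffunE. Qed.

Lemma scaleVE n (a : K) (x : Vn n) t : (a *: x) t = a * x t.
Proof. by rewrite ffunE. Qed.

Lemma sliceP m (w w' : Vn m.+1) :
  (forall b, slice w b = slice w' b) -> w = w'.
Proof.
move=> e; apply/ffunP => t; have [s [b ->]] := tuple_rconsP t.
by have /ffunP/(_ s) := e b; rewrite !ffunE.
Qed.

Lemma sum_rcons m (f : m.+1.-tuple bool -> K) :
  \sum_t f t = \sum_(s : m.-tuple bool) \sum_b f (rcons_tuple s b).
Proof.
rewrite pair_big /= (reindex (fun p : m.-tuple bool * bool =>
  rcons_tuple p.1 p.2)) //=.
exists (fun t => ([tuple tnth t (widen_ord (leqnSn m) i) | i < m],
                  tnth t ord_max)) => [[s b] _|t _] /=.
  congr (_, _); last exact: tnth_rcons_max.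
  by apply: eq_from_tnth => i; rewrite tnth_mktuple; exact: tnth_rcons_widen.
have [s [b ->]] := tuple_rconsP t.
rewrite (@tnth_rcons_max _ s b) //; congr rcons_tuple.
by apply: eq_from_tnth => i; rewrite tnth_mktuple; exact: tnth_rcons_widen.
Qed.

Lemma tensor_op_rcons m (A : 'I_m.+1 -> endoV R) (B : 'I_m -> endoV R)
    (w : Vn m.+1) b :
  (forall i, A (widen_ord (leqnSn m) i) = B i) ->
  slice (tensor_op A w) b =
  \sum_c (A ord_max b c) *: tensor_op B (slice w c).
Proof.
move=> AB; apply/ffunP => t; rewrite !ffunE sum_rcons sum_ffunE exchange_big.
apply: eq_bigr => c _; rewrite !ffunE [_ *: _]mulr_sumr; apply: eq_bigr => s _.
rewrite big_ord_recr /= !tnth_rcons_max // ffunE mulrA; congr (_ * _).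
rewrite mulrC; congr (_ * _); apply: eq_bigr => i _.
by rewrite AB (@tnth_rcons_widen _ t b i) // (@tnth_rcons_widen _ s c i).
Qed.

Lemma tensor_op_id n (w : Vn n) (A : 'I_n -> endoV R) :
  (forall i, A i = @opI R) -> tensor_op A w = w.
Proof.
move=> AI; apply/ffunP => t; rewrite ffunE (bigD1 t) //= big1 => [|i _].
  rewrite mul1r big1 ?addr0 // => s st.
  have [i ti]: exists i, tnth t i != tnth s i.
    apply/existsP; apply/contraNT: st; rewrite negb_exists => /forallP e.
    by apply/eqP/eq_from_tnth => i; have := e i; rewrite negbK => /eqP.
  by rewrite (bigD1 i) //= AI /opI (negPf ti) !mul0r.
by rewrite AI /opI eqxx.
Qed.

(** The coproduct formula for F. *)
Lemma slice_Fn m (w : Vn m.+1) b :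
  slice (Fn w) b = if b then q^-1 *: Fn (slice w true)
                   else q *: Fn (slice w false) + slice w true.
Proof.
suff -> : slice (Fn w) b = (if b then q^-1 else q) *: Fn (slice w b)
                   + (~~ b)%:R *: slice w true.
  by case: b; rewrite /= ?scale0r ?scale1r ?addr0.
have -> : slice (Fn w) b = \sum_(j < m.+1) slice (tensor_op (fun i =>
    if (i < j)%N then @opI R else if i == j then @opF R else @opKV R) w) b.
  apply/ffunP => t; rewrite ffunE /Fn !sum_ffunE; apply: eq_bigr => j _.
  by rewrite [RHS]ffunE.
rewrite big_ord_recr /=; congr (_ + _).
  rewrite /Fn scaler_sumr; apply: eq_bigr => j _.
  set B := (fun i : 'I_m => _ in RHS).
  rewrite (@tensor_op_rcons _ _ B); last first.
    by move=> i; rewrite /B /= -val_eqE.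
  have -> : ((ord_max : 'I_m.+1) < widen_ord (leqnSn m) j)%N = false.
    by rewrite /=; have := ltn_ord j; lia.
  have -> : (ord_max == widen_ord (leqnSn m) j) = false.
    by apply/negbTE; rewrite -val_eqE neq_ltn /= ltn_ord orbT.
  rewrite big_bool /=; case: b; rewrite /opKV /=.
    by rewrite scale0r addr0.
  by rewrite scale0r add0r.
rewrite (@tensor_op_rcons _ _ (fun=> @opI R)) => [|i]; last first.
  by rewrite /= ltn_ord.
rewrite ltnn eqxx big_bool /= !tensor_op_id // /opF andbF andbT scale0r addr0.
by [].
Qed.

Lemma slice_tensor_last m (x : Vn m) (v : bool -> K) b :
  slice (tensor_last x v) b = v b *: x.
Proof.
apply/ffunP => t; rewrite !ffunE tnth_rcons_max // [RHS]mulrC; congr (x _ * _).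
by apply: eq_from_tnth => i; rewrite tnth_mktuple; exact: tnth_rcons_widen.
Qed.

Lemma slice_add m (x y : Vn m.+1) b : slice (x + y) b = slice x b + slice y b.
Proof. by apply/ffunP => t; rewrite !ffunE. Qed.

Lemma slice_scale m a (x : Vn m.+1) b : slice (a *: x) b = a *: slice x b.
Proof. by apply/ffunP => t; rewrite !ffunE. Qed.

Lemma slice_opp m (x : Vn m.+1) b : slice (- x) b = - slice x b.
Proof. by apply/ffunP => t; rewrite !ffunE. Qed.

Lemma slice_tensor_opI m (x : Vn m) c b :
  slice (tensor_last x (@opI R ^~ c)) b = if b == c then x else 0.
Proof. by rewrite slice_tensor_last /opI; case: eqP; rewrite ?scale1r ?scale0r. Qed.

Lemma slice_tensor_opE m (x : Vn m) c b :
  slice (tensor_last x (@opE R ^~ c)) b = if b && ~~ c then x else 0.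
Proof.
by rewrite slice_tensor_last /opE; case: (b && ~~ c); rewrite ?scale1r ?scale0r.
Qed.

Lemma slice_theta m (w : Vn m.+1) b :
  slice (theta w) b = if b then
    theta (slice w true) - (q - q^-1) *: Fn (theta (slice w false))
  else theta (slice w false).
Proof.
have -> : theta w = \sum_(c : bool)
    (tensor_last (theta (slice w c)) (@opI R ^~ c) -
     (q - q^-1) *: tensor_last (Fn (theta (slice w c))) (@opE R ^~ c)).
  by [].
rewrite big_bool; move: (q - q^-1) => h.
have e c := slice_tensor_opI (theta (slice w c)) c b.
have f c := slice_tensor_opE (Fn (theta (slice w c))) c b.
move: (e true) (e false) (f true) (f false) => {e f}.
do 4 move: (tensor_last _ _) => ?; move=> e1 e2 e3 e4.
rewrite !(slice_add, slice_opp, slice_scale) e1 e2 e3 e4 {e1 e2 e3 e4}.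
move: (Fn _) (Fn _) => ? ?; move: (theta _) (theta _) => ? ?.
by case: b; rewrite /= !scaler0 ?subr0 ?add0r ?addr0.
Qed.

(** The off-diagonal part of the generator matrix exchanges v_+ v_- and v_- v_+. *)
Definition swapt n (i j : 'I_n) (t : n.-tuple bool) : n.-tuple bool :=
  [tuple tnth t (tperm i j x) | x < n].

Lemma swaptE n (i j : 'I_n) t x : tnth (swapt i j t) x = tnth t (tperm i j x).
Proof. by rewrite tnth_mktuple. Qed.

Lemma swaptK n (i j : 'I_n) : involutive (swapt i j).
Proof. by move=> t; apply: eq_from_tnth => x; rewrite !swaptE tpermK. Qed.

Lemma gen_opE n (i j : 'I_n) (w : Vn n) t : i != j ->
  gen_op i j w t = if tnth t i == tnth t j then 0 else
    (if tnth t i then - q^-1 else - q) * w t + w (swapt i j t).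
Proof.
move=> ij; rewrite ffunE; case: eqVneq => tij.
  rewrite big1 // => s _; rewrite tij /gen_mx.
  by case: (tnth t j); rewrite mul0r.
rewrite (bigD1 t) /=; last by apply/forallP => x; apply/implyP.
have st : swapt i j t != t.
  apply/eqP => /(congr1 (fun s => tnth s i)); rewrite swaptE tpermL => e.
  by rewrite e eqxx in tij.
rewrite (bigD1 (swapt i j t)) /=; last first.
  rewrite st andbT; apply/forallP => x; apply/implyP => /andP[xi xj].
  by rewrite swaptE tpermD // eq_sym.
rewrite [X in _ + (_ + X)]big1 ?addr0 => [|s /andP[/andP[/forallP sg s1] s2]].
  rewrite !swaptE tpermL tpermR; move: tij.
  by case: (tnth t i); case: (tnth t j) => //= _; rewrite mul1r.
case: (eqVneq (tnth s i) (tnth s j)) => sij.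
  rewrite sij /gen_mx; case: (tnth t i) => //; case: (tnth t j) => //;
  by case: (tnth s j); rewrite mul0r.
suff: (s == t) || (s == swapt i j t) by rewrite (negPf s1) (negPf s2).
case: (eqVneq (tnth s i) (tnth t i)) => si; [apply/orP; left|apply/orP; right].
  apply/eqP/eq_from_tnth => x; have [->//|xi] := eqVneq x i.
  have [->|xj] := eqVneq x j.
    move: si sij tij; case: (tnth s i); case: (tnth s j); case: (tnth t i);
    by case: (tnth t j).
  by have := sg x; rewrite xi xj => /eqP.
apply/eqP/eq_from_tnth => x; rewrite swaptE; have [->|xi] := eqVneq x i.
  rewrite tpermL; move: si sij tij.
  by case: (tnth s i); case: (tnth s j); case: (tnth t i); case: (tnth t j).
have [->|xj] := eqVneq x j.
  rewrite tpermR; move: si sij tij.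
  by case: (tnth s i); case: (tnth s j); case: (tnth t i); case: (tnth t j).
by have := sg x; rewrite xi xj => /eqP ->; rewrite tpermD // eq_sym.
Qed.

Lemma slice_gen_op m (i j : 'I_m) (i' j' : 'I_m.+1) (w : Vn m.+1) b :
  i != j -> i' = i :> nat -> j' = j :> nat ->
  slice (gen_op i' j' w) b = gen_op i j (slice w b).
Proof.
move=> ij ei ej; apply/ffunP => t.
have ij' : i' != j' by rewrite -val_eqE /= ei ej.
rewrite [LHS]ffunE !gen_opE // (tnth_rcons_widen _ _ ei) (tnth_rcons_widen _ _ ej).
rewrite 2![slice w b _]ffunE; case: ifP => // _; congr (_ + w _).
apply: eq_from_tnth => x; rewrite swaptE.
have [xm|xm] := ltnP x m.
  have [o ex] : exists o : 'I_m, x = o :> nat by exists (Ordinal xm).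
  rewrite (tnth_rcons_widen _ _ ex) swaptE; apply: tnth_rcons_widen.
  case: (tpermP i j o) => [oi|oj|oi oj].
  - have -> : x = i' by apply: val_inj; rewrite /= ex oi ei.
    by rewrite tpermL.
  - have -> : x = j' by apply: val_inj; rewrite /= ex oj ej.
    by rewrite tpermR.
  - rewrite tpermD //; apply/eqP => e; [apply: oi|apply: oj]; apply: val_inj.
      by rewrite /= -ex -e.
    by rewrite /= -ex -e.
have {xm} ex : x = m :> nat by have := ltn_ord x; lia.
rewrite (tnth_rcons_max _ _ ex) tpermD ?(tnth_rcons_max _ _ ex) //.
  by rewrite -val_eqE /= ex ei; have := ltn_ord i; lia.
by rewrite -val_eqE /= ex ej; have := ltn_ord j; lia.
Qed.

Lemma slice2_gen_op m (i j : 'I_m.+2) (w : Vn m.+2) a b :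
  i = m :> nat -> j = m.+1 :> nat ->
  slice (slice (gen_op i j w) b) a = if a == b then 0 else
    (if a then - q^-1 else - q) *: slice (slice w b) a + slice (slice w a) b.
Proof.
move=> ei ej; apply/ffunP => t.
have ij' : i != j by rewrite -val_eqE /= ei ej; lia.
have ei' : i = (ord_max : 'I_m.+1) :> nat by [].
rewrite 2!ffunE gen_opE // (tnth_rcons_widen _ _ ei') !tnth_rcons_max //.
case: ifP => ab; first by rewrite ffunE.
rewrite addVE scaleVE 4!ffunE; congr (_ + w _).
apply: eq_from_tnth => x; rewrite swaptE; case: tpermP => [->|->|xi xj].
- by rewrite (tnth_rcons_widen _ _ ei') !tnth_rcons_max.
- by rewrite (tnth_rcons_widen _ _ ei') !tnth_rcons_max.
have x1 : (x < m.+1)%N.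
  by move/eqP: xj; rewrite -val_eqE /= ej; have := ltn_ord x; lia.
have x2 : (x < m)%N by move/eqP: xi; rewrite -val_eqE /= ei; lia.
have [o1 e1] : exists o : 'I_m.+1, x = o :> nat by exists (Ordinal x1).
have [o2 e2] : exists o : 'I_m, o1 = o :> nat.
  by rewrite -e1; exists (Ordinal x2).
by rewrite !(tnth_rcons_widen _ _ e1) !(tnth_rcons_widen _ _ e2).
Qed.

End Slices.

(** * Generators and the bar involution *)

(** Identities between the components of a vector with respect to its last two
factors. *)
Section Algebra.
Variables (K : fieldType) (T : finType) (q : K) (h : K).
Hypotheses (q0 : q != 0) (hE : h = q - q^-1).
Implicit Types x y z u : {ffun T -> K^o}.

Let addfE x y t : (x + y) t = x t + y t. Proof. by rewrite ffunE. Qed.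
Let oppfE x t : (- x) t = - x t. Proof. by rewrite ffunE. Qed.
Let scalefE (a : K) x t : (a *: x) t = a * x t. Proof. by rewrite ffunE. Qed.
Let fE := (addfE, oppfE, scalefE).

Lemma alg_Fn1 x y z :
  - q^-1 *: (q *: (q^-1 *: x) + z) + q^-1 *: (q *: y + z) =
  q *: (q^-1 *: (- q^-1 *: x + y)) + 0.
Proof. by apply/ffunP => t; rewrite addr0 !fE; field. Qed.

Lemma alg_Fn2 x y z :
  - q *: (q^-1 *: (q *: x + z)) + (q *: (q^-1 *: y) + z) =
  q^-1 *: (q *: (- q *: x + y) + 0).
Proof. by apply/ffunP => t; rewrite addr0 !fE; field. Qed.

Lemma alg_Fn3 x y :
  0 = q *: (q *: 0 + (- q^-1 *: x + y)) + (- q *: y + x).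
Proof. by apply/ffunP => t; rewrite scaler0 add0r !fE ffunE; field. Qed.

Lemma alg_theta1 (y z fu : {ffun T -> K^o}) :
  - q^-1 *: (y - h *: fu) + (z - h *: (q *: fu + (y - h *: fu))) =
  (- q *: y + z) - h *: 0.
Proof. by apply/ffunP => t; rewrite scaler0 subr0 !fE hE; field. Qed.

Lemma alg_theta2 (y z fu : {ffun T -> K^o}) :
  - q *: (z - h *: (q *: fu + (y - h *: fu))) + (y - h *: fu) =
  (- q^-1 *: z + y) - h *: (q *: 0 + ((- q *: y + z) - h *: 0)).
Proof. by apply/ffunP => t; rewrite !scaler0 add0r subr0 !fE hE; field. Qed.

Lemma alg_theta3 (fy fz : {ffun T -> K^o}) :
  0 = 0 - h *: (- q^-1 *: fz + fy) - h *: (q^-1 *: (- q *: fy + fz)).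
Proof. by apply/ffunP => t; rewrite !fE ffunE; field. Qed.

End Algebra.

#[local] Arguments theta : simpl never.

Section Commute.
Variable R : realType.
Local Notation K := (Kq R).
Local Notation q := (q R).
Local Notation Vn := (Vn R).

Lemma Fn0 n : Fn (0 : Vn n) = 0.
Proof.
have := Fn_is_linear 1 (0 : Vn n) 0.
by rewrite !scale1r addr0 => /eqP; rewrite -subr_eq subrr => /eqP <-.
Qed.

Lemma theta0 n : theta (0 : Vn n) = 0.
Proof.
have := theta_antilinear 1 (0 : Vn n) 0.
by rewrite rmorph1 !scale1r addr0 => /eqP; rewrite -subr_eq subrr => /eqP <-.
Qed.

Lemma barN_q : bar (- q) = - q^-1.
Proof. by rewrite rmorphN /= bar_q. Qed.

Lemma barN_qV : bar (- q^-1) = - q.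
Proof. by rewrite rmorphN fmorphV /= bar_q invrK. Qed.

Let end2 m (w : Vn m.+2) a b := slice (slice w b) a.

Lemma slice2P m (w w' : Vn m.+2) :
  (forall a b, end2 w a b = end2 w' a b) -> w = w'.
Proof. by move=> e; apply: sliceP => b; apply: sliceP => a; apply: e. Qed.

Lemma slice2_Fn m (w : Vn m.+2) :
  [/\ end2 (Fn w) true true = q^-1 *: (q^-1 *: Fn (end2 w true true)),
      end2 (Fn w) false true =
        q^-1 *: (q *: Fn (end2 w false true) + end2 w true true),
      end2 (Fn w) true false =
        q *: (q^-1 *: Fn (end2 w true false)) + end2 w true true &
      end2 (Fn w) false false =
        q *: (q *: Fn (end2 w false false) + end2 w true false)
        + end2 w false true].
Proof.
by split; rewrite /end2 !(slice_Fn, slice_add, slice_scale).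
Qed.

Lemma slice2_theta m (w : Vn m.+2) h : h = q - q^-1 ->
  [/\ end2 (theta w) false false = theta (end2 w false false),
      end2 (theta w) true false =
        theta (end2 w true false) - h *: Fn (theta (end2 w false false)),
      end2 (theta w) false true = theta (end2 w false true) -
        h *: (q *: Fn (theta (end2 w false false)) +
          (theta (end2 w true false) - h *: Fn (theta (end2 w false false)))) &
      end2 (theta w) true true =
        theta (end2 w true true) - h *: Fn (theta (end2 w false true)) -
        h *: (q^-1 *: Fn (theta (end2 w true false) -
                          h *: Fn (theta (end2 w false false))))].
Proof.
move=> hE.
have subZ n (x y : Vn n.+1) b : slice (x - h *: y) b = slice x b - h *: slice y b.
  by rewrite slice_add slice_opp slice_scale.
have st n (v : Vn n.+1) b : slice (theta v) b =
    if b then theta (slice v true) - h *: Fn (theta (slice v false))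
    else theta (slice v false).
  by rewrite hE; exact: slice_theta.
rewrite /end2 (st _ w false) (st _ w true) !st.
have aux n (x y : Vn n.+1) b x' y0 y1 :
    slice x b = x' -> slice y false = y0 -> slice y true = y1 ->
    slice (x - h *: Fn y) b =
    x' - h *: (if b then q^-1 *: Fn y1 else q *: Fn y0 + y1).
  by move=> <- <- <-; rewrite subZ slice_Fn.
by split; [by []|by []| |]; apply: aux; apply: st.
Qed.

Lemma gen_op_is_linear n (i j : 'I_n) (a : K) (x y : Vn n) : i != j ->
  gen_op i j (a *: x + y) = a *: gen_op i j x + gen_op i j y.
Proof.
move=> ij; apply/ffunP => t; rewrite addVE scaleVE !gen_opE //.
by case: ifP => _; rewrite ?mulr0 ?addr0 // !addVE !scaleVE; ring.
Qed.

Lemma gen_opZ n (i j : 'I_n) (a : K) (x : Vn n) : i != j ->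
  gen_op i j (a *: x) = a *: gen_op i j x.
Proof.
move=> ij; rewrite -[a *: x]addr0 gen_op_is_linear //.
suff -> : gen_op i j (0 : Vn n) = 0 by rewrite addr0.
by apply/ffunP => t; rewrite gen_opE // !ffunE; case: ifP; rewrite ?mulr0 ?addr0.
Qed.

(** If the generator does not touch the last factor, induction applies. If it
does, both sides are computed from the four components of w with respect to the
last two factors. *)
Lemma gen_op_Fn n (i j : 'I_n) (w : Vn n) : j = i.+1 :> nat ->
  gen_op i j (Fn w) = Fn (gen_op i j w).
Proof.
elim: n => [|n IHn] in i j w *; first by case: i.
move=> ij; have ltj := ltn_ord j.
have [jn|jn] := ltnP j n.
  have lti : (i < n)%N by lia.
  pose i1 : 'I_n := Ordinal lti; pose j1 : 'I_n := Ordinal jn.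
  have ij1 : i1 != j1 by rewrite -val_eqE /= ij; lia.
  have sg v b : slice (gen_op i j v) b = gen_op i1 j1 (slice v b).
    exact: slice_gen_op.
  apply: sliceP => b; rewrite sg !slice_Fn; case: b.
    by rewrite gen_opZ // sg IHn.
  by rewrite gen_op_is_linear // !sg IHn.
case: n => [|n] in i j w ij {IHn} ltj jn *; first by lia.
have ei : i = n :> nat by lia.
have ej : j = n.+1 :> nat by lia.
have sg v a b : end2 (gen_op i j v) a b = if a == b then 0 else
    (if a then - q^-1 else - q) *: end2 v a b + end2 v b a.
  exact: slice2_gen_op.
have q0 : q != 0 := q_neq0 R.
apply: slice2P => a b; rewrite sg.
have [f1 f2 f3 f4] := slice2_Fn w.
have [] := slice2_Fn (gen_op i j w); rewrite !sg /= => g1 g2 g3 g4.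
case: a; case: b; rewrite /= ?g1 ?g2 ?g3 ?g4 ?f1 ?f2 ?f3 ?f4.
- by rewrite Fn0 !scaler0.
- by rewrite Fn_is_linear; exact: alg_Fn1.
- by rewrite Fn_is_linear; exact: alg_Fn2.
- by rewrite Fn0; exact: alg_Fn3.
Qed.

(** The induction is the one used for F; the corrections by F in the definition
of theta are moved past the generator with [gen_op_Fn]. *)
Lemma gen_op_theta n (i j : 'I_n) (w : Vn n) : j = i.+1 :> nat ->
  gen_op i j (theta w) = theta (gen_op i j w).
Proof.
elim: n => [|n IHn] in i j w *; first by case: i.
move=> ij; have ltj := ltn_ord j.
have [jn|jn] := ltnP j n.
  have lti : (i < n)%N by lia.
  pose i1 : 'I_n := Ordinal lti; pose j1 : 'I_n := Ordinal jn.
  have ij1 : i1 != j1 by rewrite -val_eqE /= ij; lia.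
  have sg v b : slice (gen_op i j v) b = gen_op i1 j1 (slice v b).
    exact: slice_gen_op.
  have gB h (x y : Vn n) : gen_op i1 j1 (x - h *: Fn y) =
      gen_op i1 j1 x - h *: Fn (gen_op i1 j1 y).
    have -> u : x - h *: u = (- h) *: u + x by rewrite scaleNr addrC.
    rewrite gen_op_is_linear // gen_op_Fn //.
    by move: (gen_op _ _ _) => u; move: (Fn _) => v; rewrite scaleNr addrC.
  have tg b : gen_op i1 j1 (theta (slice w b)) = theta (slice (gen_op i j w) b).
    by rewrite sg IHn.
  apply: sliceP => b; etransitivity; first exact: sg.
  etransitivity; last by symmetry; exact: slice_theta.
  etransitivity; first by apply: f_equal; exact: slice_theta.
  by case: b; [rewrite gB !tg|rewrite tg].
case: n => [|n] in i j w ij {IHn} ltj jn *; first by lia.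
have ei : i = n :> nat by lia.
have ej : j = n.+1 :> nat by lia.
have sg v a b : end2 (gen_op i j v) a b = if a == b then 0 else
    (if a then - q^-1 else - q) *: end2 v a b + end2 v b a.
  exact: slice2_gen_op.
have q0 : q != 0 := q_neq0 R.
have [h hE] : exists h, h = q - q^-1 by exists (q - q^-1).
have := slice2_theta (gen_op i j w) hE; have := slice2_theta w hE.
rewrite !sg /= => f g; apply: slice2P => a b; etransitivity; first exact: sg.
move: (theta (gen_op i j w)) g => Y [g1 g2 g3 g4].
move: (theta w) f => X [f1 f2 f3 f4].
rewrite theta0 Fn0 !theta_antilinear barN_q barN_qV in g1 g2 g3 g4.
case: a; case: b; rewrite /= ?g1 ?g2 ?g3 ?g4 ?f1 ?f2 ?f3 ?f4.
- have F0 (u : Vn n) : Fn (u - h *: 0) = Fn u by rewrite scaler0 subr0.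
  by rewrite F0 !Fn_is_linear; exact: alg_theta3.
- exact: alg_theta1.
- exact: alg_theta2.
- by [].
Qed.

(** With only minus signs at the right end and plus signs before them there is
nothing for the raising operator to act on, so this coefficient of [theta w]
has no correction term. *)
Lemma theta_coef_min n (w : Vn n) (t : n.-tuple bool) p :
  (forall i : 'I_n, tnth t i = (i < p)%N) -> theta w t = bar (w t).
Proof.
elim: n => [|n IHn] in w t p *; first by rewrite ffunE.
have [s [b te]] := tuple_rconsP t; rewrite {t}te => tP.
have sP (i : 'I_n) : tnth s i = (i < p)%N.
  have iw : widen_ord (leqnSn n) i = i :> nat by [].
  by have := tP (widen_ord (leqnSn n) i); rewrite (tnth_rcons_widen _ _ iw).
have sl (v : Vn n.+1) c : v (rcons_tuple s c) = slice v c s by rewrite ffunE.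
have bP : b = (n < p)%N by have := tP ord_max; rewrite tnth_rcons_max.
rewrite !sl -(IHn (slice w b) s p) // slice_theta; case: b bP {tP} => // pn.
have F0 m (v : Vn m) u : (forall i, tnth u i = true) -> Fn v u = 0.
  move=> uT; rewrite /Fn sum_ffunE big1 // => j _; rewrite ffunE big1 // => y _.
  by rewrite (bigD1 j) //= ltnn eqxx /opF uT !mul0r.
rewrite addVE oppVE scaleVE F0 ?mulr0 ?subr0 // => i.
by rewrite sP; have := ltn_ord i; lia.
Qed.

End Commute.

(** * The dual canonical coefficients *)

Section DualCanonical.
Variables (K : fieldType) (c : K) (n : nat).
Hypothesis c0 : c != 0.
Implicit Types (D : diagram n) (k : nat) (s t l : n.-tuple bool).

(** Bottom vertices carry the sign opposite to that of v_-^k v_+^(n-k), so that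
in a compatible orientation the two ends of every link, between the lines or not,
have opposite signs. *)
Definition sign_at k l (u : vertex n) : bool :=
  match u with inl i => (i < k)%N | inr j => tnth l (rev_ord j) end.

Definition oriented k D l :=
  [forall u, sign_at k l u != sign_at k l (val D u)].

Definition flips t l := (\sum_i (tnth t i && ~~ tnth l i))%N.

(** The coefficient at v_l of the dual canonical functional of the label of D, for
c = -q^-1: each link between top vertices is a cap with value 1 in the
orientation of the label and c in the opposite one. *)
Definition dual_coef k D l : K :=
  if oriented k D l then c ^+ flips (lab k D) l else 0.

Section Step.
Variables (D : diagram n) (a b : 'I_n) (k : nat).
Hypotheses (ab : b = a.+1 :> nat) (nab : val D (inr a) != inr b).
Hypotheses (kn : (k <= n)%N) (Dk : in_ind_basis k D).
Hypotheses (ca : ~~ closes k D (inr a)) (cb : closes k D (inr b)).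

Let i := rev_ord b.
Let j := rev_ord a.
Let A := val D (inr a).
Let B := val D (inr b).

Let rest l := [forall u, [&& u != inr a, u != inr b, u != A & u != B] ==>
                         (sign_at k l u != sign_at k l (val D u))].

Lemma orientedE l : oriented k D l =
  [&& sign_at k l A != tnth l j, sign_at k l B != tnth l i & rest l].
Proof.
apply/forallP/and3P => [h|[hA hB /forallP h] u].
  split; last by apply/forallP => u; apply/implyP.
    by have := h (inr a); rewrite eq_sym.
  by have := h (inr b); rewrite eq_sym.
case: (eqVneq u (inr a)) => [->|ua]; first by rewrite eq_sym.
case: (eqVneq u (inr b)) => [->|ub]; first by rewrite eq_sym.
case: (eqVneq u A) => [->|uA]; first by rewrite {2}/A diagK.
case: (eqVneq u B) => [->|uB]; first by rewrite {2}/B diagK.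
by have := h u; rewrite ua ub uA uB.
Qed.

Lemma oriented_surg l : oriented k (surg ab nab) l =
  [&& tnth l i != tnth l j, sign_at k l A != sign_at k l B & rest l].
Proof.
have [Ea Eb EA EB EO] := surgE ab nab.
apply/forallP/and3P => [h|[hA hB /forallP h] u].
  split.
  - by have := h (inr b); rewrite /= Eb.
  - by have := h A; rewrite /= EA.
  apply/forallP => u; apply/implyP => /and4P[ua ub uA uB].
  by have := h u; rewrite /= EO.
rewrite /=; case: (surgP D a b u) => [->|->|-> _ _|-> _ _|ua ub uA uB] //.
- by rewrite eq_sym.
- by rewrite eq_sym.
- by have := h u; rewrite ua ub uA uB.
Qed.

Lemma sign_at_swapt l u : u != inr a -> u != inr b ->
  sign_at k (swapt i j l) u = sign_at k l u.
Proof.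
case: u => x //= xa xb; rewrite swaptE tpermD // /i /j.
  by apply: contraNneq xb => /rev_ord_inj ->.
by apply: contraNneq xa => /rev_ord_inj ->.
Qed.

Lemma rest_swapt l : rest (swapt i j l) = rest l.
Proof.
apply: eq_forallb => u; case: and4P => // -[ua ub uA uB].
rewrite !sign_at_swapt //.
  by apply: contraNneq uA => e; rewrite /A -e diagK.
by apply: contraNneq uB => e; rewrite /B -e diagK.
Qed.

(** Composing the functional of [D] with the generator gives the functional of
the product. When the signs of l at a and b differ, l is compatible with the new
links if and only if exactly one of l and its exchange is compatible with the
old ones; the matrix of the generator supplies the change of the exponent. *)
Lemma dual_coef_surg l : dual_coef k (surg ab nab) l =
  if tnth l i == tnth l j then 0
  else (if tnth l i then c else c^-1) * dual_coef k D l
       + dual_coef k D (swapt i j l).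
Proof.
rewrite /dual_coef oriented_surg !orientedE rest_swapt.
have [Ab Ba Aa Bb AB] := surg_facts ab nab.
rewrite !sign_at_swapt // !swaptE tpermL tpermR.
case: eqVneq => //= lij.
case: (rest l); rewrite ?andbF ?andbT ?mulr0 ?addr0 //.
have ij : i != j by apply: contraNneq lij => ->.
have flipE t s : flips t s = ((tnth t i && ~~ tnth s i) +
    (tnth t j && ~~ tnth s j) +
    \sum_(x | (x != i) && (x != j)) (tnth t x && ~~ tnth s x))%N.
  by rewrite /flips (bigD1 i) //= (bigD1 j) 1?eq_sym //= addnA.
have tx D' x : tnth (lab k D') x = closes k D' (inr (rev_ord x)).
  by rewrite -tnth_lab rev_ordK.
rewrite !flipE !tx /i /j !rev_ordK !closes_surg // tpermL tpermR (negPf ca) cb.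
rewrite /= ?swaptE ?tpermL ?tpermR -/i -/j.
set r := (\sum_(x | _) (tnth (lab k D) x && ~~ tnth l x))%N.
have -> : (\sum_(x | (x != i) && (x != j))
    (tnth (lab k (surg ab nab)) x && ~~ tnth l x))%N = r.
  apply: eq_bigr => x /andP[xi xj]; rewrite !tx closes_surg // tpermD //.
    by apply: contraNneq xj => e; rewrite /j e rev_ordK.
  by apply: contraNneq xi => e; rewrite /i e rev_ordK.
have -> : (\sum_(x | (x != i) && (x != j))
    (tnth (lab k D) x && ~~ tnth (swapt i j l) x))%N = r.
  apply: eq_bigr => x /andP[xi xj]; rewrite swaptE tpermD // eq_sym //.
move: lij; case: (tnth l i); case: (tnth l j) => // _;
  case: (sign_at k l A); case: (sign_at k l B); rewrite /= ?mulr0 ?addr0 ?add0r //.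
- by rewrite add0n add1n exprS.
- by rewrite add0n add1n exprS mulrA mulVf // mul1r.
Qed.

End Step.
End DualCanonical.

(** * Diagrams as dual canonical functionals *)

Section Functionals.
Variable R : realType.
Local Notation K := (Kq R).
Local Notation q := (q R).
Local Notation Vn := (Vn R).
Variables (n : nat) (zeta : TL R n -> 'End(Vn n)).
Hypothesis zetaP : is_zeta_star zeta.
Implicit Types (D : diagram n) (k : nat) (s t l : n.-tuple bool).

Definition dual_vec k D l : K := dual_coef (- q^-1) k D l.

Lemma qV_neq0 : - q^-1 != 0.
Proof. by rewrite oppr_eq0 invr_eq0 q_neq0. Qed.

(** The generator is moved from the vector to the functional; this reindexes
the sum by an involution. *)
Lemma sum_swapt (i j : 'I_n) (w f g : n.-tuple bool -> K) (c1 c2 : K) : i != j ->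
  (forall l, g l = if tnth l i == tnth l j then 0
     else (if tnth l i then c1 else c2) * f l + f (swapt i j l)) ->
  \sum_l f l * (if tnth l i == tnth l j then 0
     else (if tnth l i then c1 else c2) * w l + w (swapt i j l)) =
  \sum_l g l * w l.
Proof.
move=> ij gE; pose P l := tnth l i == tnth l j.
have -> : \sum_l g l * w l =
    \sum_l (if P l then 0 else (if tnth l i then c1 else c2) * f l * w l)
    + \sum_l (if P l then 0 else f (swapt i j l) * w l).
  rewrite -big_split; apply: eq_bigr => l _ /=; rewrite gE /P; case: ifP => _.
    by rewrite mul0r addr0.
  by rewrite mulrDl.
rewrite [X in _ + X](reindex_inj (inv_inj (swaptK i j))) -big_split /=.
apply: eq_bigr => l _; rewrite /P !swaptE tpermL tpermR [tnth l j == _]eq_sym.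
case: ifP => _; first by rewrite mulr0 addr0.
by rewrite swaptK mulrDr mulrA [f l * _]mulrC.
Qed.

Definition pair_diag k D (w : Vn n) : K :=
  pairing (minus_plus R n k) (zeta (tl_basis R D) w).

(** The two properties of pairing with D that pass from D to its product with a
generator. *)
Definition realizes k D :=
  (forall w, pair_diag k D w = \sum_l dual_vec k D l * w l) /\
  (forall w, pair_diag k D (theta w) = bar (pair_diag k D w)).

Definition min_tuple k : n.-tuple bool := [tuple (i < n - k)%N | i < n].

Lemma pairing_minus_plus k (x : Vn n) : (k <= n)%N ->
  pairing (minus_plus R n k) x = x (min_tuple k).
Proof.
move=> kn; rewrite /pairing (bigD1 [tuple of mkseq (fun i => ~~ (i < k)%N) n]) //=.
rewrite ffunE eqxx mul1r big1 => [|t /negPf tm]; last by rewrite ffunE tm mul0r.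
rewrite addr0; congr (x _); apply: eq_from_tnth => i.
rewrite tnth_rev_tuple tnth_mktuple (tnth_nth true) nth_mkseq //=.
  by have := ltn_ord i; lia.
by have := ltn_ord i; lia.
Qed.

Lemma id_in_ind_basis k : in_ind_basis k (id_diagram n).
Proof. by apply/forallP => i; apply/forallP => j; rewrite ffunE. Qed.

Lemma lab_id k : (k <= n)%N -> lab k (id_diagram n) = min_tuple k.
Proof.
move=> kn; apply: eq_from_tnth => i; rewrite !tnth_mktuple.
rewrite (@closes_through _ _ _ _ (rev_ord i)) //; last by rewrite ffunE.
by rewrite /=; have := ltn_ord i; lia.
Qed.

Lemma flips_id t : flips t t = 0%N.
Proof. by rewrite /flips big1 // => i _; rewrite andbN. Qed.

Lemma realizes_id k : (k <= n)%N -> realizes k (id_diagram n).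
Proof.
move=> kn; have [_ zid _ _] := zetaP.
have pE w : pair_diag k (id_diagram n) w = w (min_tuple k).
  by rewrite /pair_diag zid id_lfunE pairing_minus_plus.
split=> w; rewrite !pE; last first.
  by apply: (@theta_coef_min _ _ _ _ (n - k)%N) => i; rewrite tnth_mktuple.
have oE l : oriented k (id_diagram n) l = (l == min_tuple k).
  apply/forallP/eqP => [h|-> u].
    apply: eq_from_tnth => i; rewrite tnth_mktuple; have := h (inr (rev_ord i)).
    rewrite ffunE /= rev_ordK; have := ltn_ord i.
    by case: (tnth l i); case: ltnP; lia.
  rewrite ffunE; case: u => x /=; rewrite tnth_mktuple /=; have := ltn_ord x;
  by case: (ltnP x k); lia.
rewrite (bigD1 (min_tuple k)) //= big1 => [|l lm].
  by rewrite /dual_vec /dual_coef oE eqxx lab_id // flips_id mul1r addr0.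
by rewrite /dual_vec /dual_coef oE (negPf lm) mul0r.
Qed.

Lemma tl_mul_basis (D' D D'' : diagram n) :
  (forall E, is_stack D' D E = (E == D'')) -> nloops D' D = 0%N ->
  tl_mul (tl_basis R D') (tl_basis R D) = tl_basis R D''.
Proof.
move=> st nl; rewrite /tl_mul (bigD1 D') //= [X in _ + X]big1 => [|E ED].
  rewrite addr0 (bigD1 D) //= [X in _ + X]big1 => [|E ED].
    rewrite addr0 (eq_bigl _ _ st) big_pred1_eq !ffunE !eqxx nl expr0 !mulr1.
    by rewrite scale1r.
  by apply: big1 => F _; rewrite !ffunE (negPf ED) mulr0 mul0r scale0r.
by apply: big1 => E' _; apply: big1 => F _; rewrite !ffunE (negPf ED) !mul0r scale0r.
Qed.

(** The anti-homomorphism turns the product of the generator with [D] into the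
generator followed by the operator of [D]. *)
Lemma realizes_surg (D : diagram n) (a b : 'I_n) k (ab : b = a.+1 :> nat)
    (nab : val D (inr a) != inr b) : (k <= n)%N -> in_ind_basis k D ->
  ~~ closes k D (inr a) -> closes k D (inr b) ->
  realizes k D -> realizes k (surg ab nab).
Proof.
move=> kn Dk ca cb [Dpsi Dtheta]; have [_ _ zM zgen] := zetaP.
have ij : rev_ord b != rev_ord a.
  by apply/eqP => /rev_ord_inj e; move: ab; rewrite e; lia.
have pE w : pair_diag k (surg ab nab) w =
    pair_diag k D (gen_op (rev_ord b) (rev_ord a) w).
  rewrite /pair_diag -(tl_mul_basis (is_stack_surg ab nab) (nloops_surg ab nab)).
  by rewrite zM comp_lfunE zgen.
split=> w; rewrite pE; last first.
  rewrite gen_op_theta ?Dtheta ?pE //=; have := ltn_ord b; rewrite ab; lia.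
rewrite Dpsi.
under eq_bigr => l _ do rewrite gen_opE //.
apply: sum_swapt => // l; rewrite /dual_vec.
rewrite (dual_coef_surg qV_neq0 ab nab kn Dk ca cb).
by rewrite invrN invrK.
Qed.

End Functionals.

(** * A diagram for each label *)

Section Existence.
Variable R : realType.
Local Notation Vn := (Vn R).
Variables (n : nat) (zeta : TL R n -> 'End(Vn n)).
Hypothesis zetaP : is_zeta_star zeta.
Implicit Types (D : diagram n) (k : nat) (s t l : n.-tuple bool).

(** Exchanging + - into - + at neighbouring vertices, that is - + into + - in the
order of the tensor factors, decreases this weight. *)
Definition weight s := (\sum_(i < n) tnth s i * i.+1)%N.

Lemma weight_swapt s (i j : 'I_n) : j = i.+1 :> nat ->
  tnth s i = false -> tnth s j = true ->
  (weight (swapt i j s) < weight s)%N.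
Proof.
move=> ij si sj; have ji : j != i by rewrite -val_eqE /= ij; lia.
have wE t : weight t = (tnth t i * i.+1 + (tnth t j * j.+1 +
    \sum_(x < n | (x != i) && (x != j)) tnth t x * x.+1))%N.
  by rewrite /weight (bigD1 i) //= (bigD1 j).
rewrite !wE !swaptE tpermL tpermR si sj ij.
rewrite (eq_bigr (fun x : 'I_n => tnth s x * x.+1)%N).
  by rewrite mul1n mul0n add0n mul1n mul0n add0n ltn_add2r.
by move=> x /andP[xi xj]; rewrite swaptE tpermD // eq_sym.
Qed.

Lemma monotone_min_tuple s :
  (forall i j : 'I_n, j = i.+1 :> nat -> tnth s j -> tnth s i) ->
  exists2 k, (k <= n)%N & s = min_tuple n k.
Proof.
move=> mono; pose m := find negb s.
have ms : (m <= n)%N by rewrite -[X in (_ <= X)%N](size_tuple s) find_size.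
exists (n - m)%N; first exact: leq_subr.
apply: eq_from_tnth => i; rewrite tnth_mktuple subKn //.
rewrite (tnth_nth false); case: ltnP => [im|mi].
  by have := before_find false im; case: nth.
have h p (x : 'I_n) : x = (m + p)%N :> nat -> ~~ tnth s x.
  elim: p x => [|p IHp] x xE.
    have mn : (find negb s < size s)%N.
      by rewrite size_tuple -/m -[m]addn0 -xE ltn_ord.
    rewrite (tnth_nth false) xE addn0; apply: nth_find.
    by rewrite has_find.
  have yn : (m + p < n)%N by have := ltn_ord x; lia.
  have xy : x = (Ordinal yn).+1 :> nat by rewrite /= xE; lia.
  by apply: contra (IHp (Ordinal yn) erefl); apply: mono.
apply/negbTE; rewrite -tnth_nth; apply: (h (i - m)%N); lia.
Qed.

(** A label that is sorted belongs to the identity diagram. Any other label has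
two neighbouring signs in the wrong order; exchanging them gives a label of
smaller weight, and multiplying its diagram by the generator at these vertices
exchanges them back. *)
Lemma exists_diagram s :
  exists D, [/\ in_ind_basis (nminus s) D, lab (nminus s) D = s
              & realizes zeta (nminus s) D].
Proof.
have [m] := ubnP (weight s); elim: m s => // m IHm s sm.
case: (boolP [exists i : 'I_n, exists j : 'I_n,
    (j == i.+1 :> nat) && (tnth s j && ~~ tnth s i)]) => [/existsP[i /existsP[j]]|].
  case/and3P => /eqP ij sj /negbTE si.
  have [D [Dk DL Dr]] := IHm _ (leq_trans (weight_swapt ij si sj) sm).
  set k := nminus _ in Dk DL Dr.
  have kn : (k <= n)%N.
    by rewrite -[X in (_ <= X)%N](size_tuple (swapt i j s)) count_size.
  pose a := rev_ord j; pose b := rev_ord i.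
  have ab : b = a.+1 :> nat by rewrite /= ij; have := ltn_ord j; rewrite ij; lia.
  have cE x : closes k D (inr x) = tnth (swapt i j s) (rev_ord x).
    by rewrite -tnth_lab DL.
  have ca : ~~ closes k D (inr a) by rewrite cE rev_ordK swaptE tpermR si.
  have cb : closes k D (inr b) by rewrite cE rev_ordK swaptE tpermL sj.
  have nab : val D (inr a) != inr b.
    by apply: contraNneq ca => /(closes_top kn) ->; rewrite ab.
  have Sk := surg_in_ind_basis ab nab kn Dk ca cb.
  have SL : lab k (surg ab nab) = s.
    apply: eq_from_tnth => x; rewrite -[x]rev_ordK tnth_lab closes_surg //.
    rewrite cE swaptE; congr (tnth s _); rewrite /a /b.
    case: (tpermP (rev_ord j) (rev_ord i)) => [->|->|/eqP xa /eqP xb].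
    - by rewrite rev_ordK tpermL rev_ordK.
    - by rewrite rev_ordK tpermR rev_ordK.
    rewrite rev_ordK tpermD //.
      by apply: contraNneq xb => ->.
    by apply: contraNneq xa => ->.
  have <- : k = nminus s by rewrite -SL nminus_lab.
  exists (surg ab nab); split; [exact: Sk|exact: SL|].
  exact: (realizes_surg zetaP ab nab kn Dk ca cb Dr).
rewrite negb_exists => /forallP mono.
have [k kn sE] : exists2 k, (k <= n)%N & s = min_tuple n k.
  apply: monotone_min_tuple => i j ij sj; have := mono i.
  rewrite negb_exists => /forallP/(_ j); rewrite ij eqxx sj /= negbK.
  by [].
have SL := lab_id kn; have Ik := id_in_ind_basis n k.
have sk : nminus s = k by rewrite sE -SL nminus_lab.
exists (id_diagram n); rewrite sk; split=> //; first by rewrite SL.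
exact: realizes_id.
Qed.

End Existence.

(** * Triangularity of the dual canonical coefficients *)

Section SupportOrder.
Variable n : nat.
Implicit Types k l s t : n.-tuple bool.

Lemma support_refl k : support_cond k k.
Proof. by rewrite /support_cond eqxx; apply/forallP => m. Qed.

Lemma support_trans l k s :
  support_cond k l -> support_cond l s -> support_cond k s.
Proof.
case/andP=> /eqP e /forallP kl /andP[/eqP e' /forallP ls].
rewrite /support_cond e' e eqxx.
by apply/forallP => m; apply: le_trans (kl m) (ls m).
Qed.

Lemma psumS k (m : 'I_n) :
  psum k m.+1 = psum k m + sgnb (tnth (rev_tuple k) m).
Proof.
rewrite /psum (bigD1 m) ?ltnSn //= addrC; congr (_ + _).
by apply: eq_bigl => i; rewrite ltnS ltn_neqAle andbC.
Qed.

(** A label is determined by its partial sums. *)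
Lemma support_anti k l : support_cond k l -> support_cond l k -> k = l.
Proof.
case/andP=> _ /forallP kl /andP[_ /forallP lk].
have e m : (m <= n)%N -> psum k m = psum l m.
  case: m => [|m] mn; first by rewrite /psum !big_pred0.
  by apply/eqP; rewrite eq_le (kl (Ordinal mn)) (lk (Ordinal mn)).
apply: eq_from_tnth => x; rewrite -[x]rev_ordK -(tnth_rev_tuple k) -(tnth_rev_tuple l).
set m := rev_ord x; have := psumS k m; rewrite !e ?(ltn_ord m) 1?ltnW //.
rewrite psumS => /addrI.
by case: (tnth (rev_tuple k) m); case: (tnth (rev_tuple l) m) => // /eqP.
Qed.

Lemma psum_flips s l m :
  psum s m - psum l m =
  2%:Z * #|[pred x : 'I_n | (x < m)%N &&
             (tnth (rev_tuple s) x && ~~ tnth (rev_tuple l) x)]|%:Z -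
  2%:Z * #|[pred x : 'I_n | (x < m)%N &&
             (tnth (rev_tuple l) x && ~~ tnth (rev_tuple s) x)]|%:Z.
Proof.
have cE (P : pred 'I_n) : #|[pred x : 'I_n | (x < m)%N && P x]|%:Z =
    \sum_(x < n | (x < m)%N) (P x)%:Z.
  rewrite -sum1_card (big_morph Posz PoszD (erefl _)) big_mkcondr /=.
  by apply: eq_bigr => x _; case: (P x).
rewrite !cE /psum -sumrB !mulr_sumr -sumrB; apply: eq_bigr => x _.
by case: (tnth (rev_tuple s) x); case: (tnth (rev_tuple l) x).
Qed.

End SupportOrder.

Section Unitriangular.
Variables (n : nat) (D : diagram n) (k : nat).
Hypotheses (kn : (k <= n)%N) (Dk : in_ind_basis k D).
Implicit Types l : n.-tuple bool.

Lemma sign_at_lab u : sign_at k (lab k D) u = closes k D u.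
Proof. by case: u => i; rewrite /= ?closes_bottom // tnth_lab. Qed.

Lemma oriented_lab : oriented k D (lab k D).
Proof.
apply/forallP => u; rewrite !sign_at_lab closes_diag //.
by case: closes.
Qed.

(** If l agrees with the label at all closing vertices, compatibility forces it to
agree at their partners, the opening ones. *)
Lemma flips_eq0 l : oriented k D l -> flips (lab k D) l = 0%N -> l = lab k D.
Proof.
move=> /forallP lo /eqP; rewrite sum_nat_eq0 => /forallP l0.
have up u : closes k D u -> sign_at k l u.
  case: u => i cu /=; first by rewrite -(closes_bottom i kn Dk).
  have := l0 (rev_ord i); rewrite tnth_lab cu /=.
  by case: (tnth l _).
apply: eq_from_tnth => x; rewrite -[x]rev_ordK tnth_lab.
case cu : (closes k D (inr (rev_ord x))); first exact: (up (inr (rev_ord x))).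
have := up (val D (inr (rev_ord x))); rewrite closes_diag // cu => /(_ isT) sD.
by have := lo (inr (rev_ord x)); rewrite sD /=; case: (tnth l _).
Qed.

(* Vertices linked to the bottom line are sent to themselves. *)
Let mate (x : 'I_n) : 'I_n := if val D (inr x) is inr y then y else x.

Let mateK : involutive mate.
Proof.
move=> x; rewrite /mate; case e : (val D (inr x)) => [i|y]; first by rewrite e.
by rewrite -e diagK.
Qed.

(** The links between top vertices carry the sign + at their left end in the
label; an orientation moves some of these signs to the right. *)
Lemma oriented_support l : oriented k D l -> support_cond l (lab k D).
Proof.
move=> /forallP lo; pose T x := tnth (rev_tuple (lab k D)) x.
pose L x := tnth (rev_tuple l) x.
have TE x : T x = closes k D (inr x) by rewrite /T tnth_rev_tuple tnth_lab.
have LE x : L x = sign_at k l (inr x) by rewrite /L tnth_rev_tuple.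
pose up m := [pred x : 'I_n | (x < m)%N && (T x && ~~ L x)].
pose dn m := [pred x : 'I_n | (x < m)%N && (L x && ~~ T x)].
have linked x : T x != L x -> exists2 y, val D (inr x) = inr y & mate x = y.
  rewrite /mate TE LE; have := lo (inr x); have := closes_diag D (inr x) kn.
  case: (val D (inr x)) => [i|y]; last by exists y.
  rewrite closes_bottom //= => ->.
  by case: (tnth l _); case: closes.
have swap x y : val D (inr x) = inr y -> T y = ~~ T x /\ L y = ~~ L x.
  move=> e; rewrite !TE !LE -e closes_diag //; split=> //.
  by have := lo (inr x); do 2 case: sign_at.
have inj_le (P Q : pred 'I_n) : (forall x, P x -> Q (mate x)) -> (#|P| <= #|Q|)%N.
  move=> PQ; rewrite -(card_imset P (inv_inj mateK)).
  by apply/subset_leq_card/subsetP => y /imsetP[x Px ->]; exact: PQ.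
have dn_up m : (#|dn m| <= #|up m|)%N.
  apply: inj_le => x /= /and3P[xm Lx Tx].
  have [|y Dx ->] := linked x; first by rewrite Lx (negPf Tx).
  have [Ty Ly] := swap _ _ Dx; rewrite Ty Ly Lx Tx !andbT.
  by move: Tx; rewrite TE (closes_top kn Dx) -leqNgt => /leq_ltn_trans ->.
have up_dn : (#|up n| <= #|dn n|)%N.
  apply: inj_le => x /= /and3P[_ Tx Lx].
  have [|y Dx ->] := linked x; first by rewrite Tx (negPf Lx).
  by have [Ty Ly] := swap _ _ Dx; rewrite Ty Ly Tx Lx ltn_ord.
apply/andP; split.
  rewrite -subr_eq0 psum_flips -/(up n) -/(dn n).
  by have := dn_up n; move: up_dn; lia.
apply/forallP => m; rewrite -subr_ge0 psum_flips -/(up m.+1) -/(dn m.+1).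
by have := dn_up m.+1; move: #|up _| #|dn _| => x y; lia.
Qed.

Variable R : realType.

Lemma dual_vec_lab : dual_vec R k D (lab k D) = 1.
Proof. by rewrite /dual_vec /dual_coef oriented_lab flips_id expr0. Qed.

Lemma dual_vec_support l : dual_vec R k D l != 0 -> support_cond l (lab k D).
Proof.
rewrite /dual_vec /dual_coef; case: ifP => [lo _|]; last by rewrite eqxx.
exact: oriented_support.
Qed.

Lemma dual_vec_qV l : l != lab k D -> in_qVZqV (dual_vec R k D l).
Proof.
move=> lN; rewrite /dual_vec /dual_coef; case: ifP => [lo|_]; last exact: in_qVZqV0.
case e : (flips _ l) => [|m]; first by rewrite (flips_eq0 lo e) eqxx in lN.
rewrite exprS; apply: in_qVZqVMr; first exact/in_qVZqVN/in_qVZqV_qV.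
elim: m {e} => [|m IHm]; first exact: in_ZqV1.
by rewrite exprS; apply: in_ZqVM => //; apply/in_ZqVN/in_qVZqV_Z/in_qVZqV_qV.
Qed.

Lemma dual_vec_Z l : in_ZqV (dual_vec R k D l).
Proof.
case: (eqVneq l (lab k D)) => [->|/dual_vec_qV/in_qVZqV_Z//].
by rewrite dual_vec_lab; exact: in_ZqV1.
Qed.

End Unitriangular.

(** * Inverting a triangular family of functionals *)

Section Triangular.
Variables (R : realType) (n : nat).
Local Notation K := (Kq R).
Local Notation Vn := (Vn R).
Implicit Types k l s t : n.-tuple bool.

Variable c : n.-tuple bool -> n.-tuple bool -> K.
Hypothesis c_diag : forall s, c s s = 1.
Hypothesis c_off : forall s l, l != s -> in_qVZqV (c s l).
Hypothesis c_support : forall s l, c s l != 0 -> support_cond l s.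

Let eval s (w : Vn n) := \sum_l c s l * w l.

(** The coordinates of w are recovered from the lowest label upwards. *)
Lemma eval_inj (w w' : Vn n) : (forall s, eval s w = eval s w') -> w = w'.
Proof.
move=> e; apply/ffunP => s.
have [m] := ubnP #|[pred l | support_cond l s]|; elim: m s => // m IHm s sm.
have := e s; rewrite /eval (bigD1 s) //= [RHS](bigD1 s) //= c_diag !mul1r.
set X := \sum_(i | _) _; set Y := \sum_(i | _) _; suff -> : X = Y by move/addIr.
apply: eq_bigr => l ls; have [->|cl] := eqVneq (c s l) 0; first by rewrite !mul0r.
have sl := c_support cl; rewrite IHm //.
rewrite -ltnS; apply: leq_ltn_trans sm; apply: proper_card.
apply/properP; split; first by apply/subsetP => t; rewrite !inE => /support_trans; apply.
exists s; rewrite ?inE ?support_refl //.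
by apply: contra ls => sl'; rewrite (support_anti sl sl').
Qed.

Definition unitriangular_at k (b : Vn n) :=
  forall l, in_qVZqV (b l - (l == k)%:R) /\
            (~~ support_cond k l -> b l - (l == k)%:R = 0).

(** Subtract from v_k its components c t k along the dual vectors of the labels t
above k, which are constructed first. *)
Lemma exists_dual_basis k :
  exists b : Vn n, (forall s, eval s b = (s == k)%:R) /\ unitriangular_at k b.
Proof.
have [m] := ubnP #|[pred t | support_cond k t]|; elim: m k => // m IHm k km.
pose P t := support_cond k t && (t != k).
have /fin_all_exists[bs bsP] : forall t, exists b : Vn n, P t ->
    (forall s, eval s b = (s == t)%:R) /\ unitriangular_at t b.
  move=> t; case Pt : (P t); last by exists 0.
  have [kt tk] := andP Pt.
  have [|b [b1 b2]] := IHm t; last by exists b.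
  rewrite -ltnS; apply: leq_ltn_trans km; apply: proper_card.
  apply/properP; split.
    by apply/subsetP => s; rewrite !inE; apply: support_trans.
  exists k; rewrite ?inE ?support_refl //.
  by apply: contra tk => tk'; rewrite (support_anti kt tk').
exists [ffun l => (l == k)%:R - \sum_(t | P t) c t k * bs t l]; split.
  move=> s; rewrite /eval.
  under eq_bigr => l _ do rewrite ffunE mulrBr mulr_sumr.
  rewrite sumrB exchange_big /=.
  have -> : \sum_l c s l * (l == k)%:R = c s k.
    rewrite (bigD1 k) //= eqxx mulr1 big1 ?addr0 // => l /negPf ->.
    by rewrite mulr0.
  have -> : \sum_(t | P t) \sum_l c s l * (c t k * bs t l) =
      \sum_(t | P t) c t k * (s == t)%:R.
    apply: eq_bigr => t /bsP[<- _]; rewrite /eval mulr_sumr.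
    by apply: eq_bigr => l _; rewrite mulrCA.
  case Ps : (P s).
    have [_ sk] := andP Ps; rewrite (negPf sk) (bigD1 s) //= eqxx mulr1 big1.
      by rewrite addr0 subrr.
    by move=> t /andP[_ /negPf ts]; rewrite eq_sym ts mulr0.
  rewrite big1 ?subr0 => [|t Pt]; last first.
    case: (eqVneq s t) => [e|_]; last by rewrite mulr0.
    by rewrite e Pt in Ps.
  have [->|sk] := eqVneq s k; first exact: c_diag.
  apply/eqP; move: Ps; rewrite /P sk andbT; apply: contraFT.
  exact: c_support.
move=> l; rewrite ffunE addrC addKr; split.
  apply/in_qVZqVN/in_qVZqV_sum => t Pt; have [_ tU] := bsP t Pt.
  have [_ tk] := andP Pt; apply: in_qVZqVMr; first by apply: c_off; rewrite eq_sym.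
  rewrite -[bs t l](subrK (l == t)%:R); apply: in_ZqVD; last exact: in_ZqV_nat.
  by have [/in_qVZqV_Z] := tU l.
move=> kl; rewrite big1 ?oppr0 // => t Pt; have [_ tU] := bsP t Pt.
have [kt _] := andP Pt; have [_ tU'] := tU l.
have tl : ~~ support_cond t l by apply: contra kl; apply: support_trans.
have := tU' tl; case: eqVneq => [e|_]; first by rewrite e support_refl in tl.
by rewrite subr0 => ->; rewrite mulr0.
Qed.

End Triangular.

(** * The canonical basis element *)

Lemma canonical_of_coord (R : realType) n (k : n.-tuple bool) (b : Vn R n) :
  theta b = b -> unitriangular_at k b -> is_canonical k b.
Proof.
move=> tb bU; split=> //; exists (fun l => b l - (l == k)%:R).
split=> [l|]; first by have [] := bU l.
apply/ffunP => s; rewrite addVE oppVE ffunE sum_ffunE.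
under eq_bigr => l _ do rewrite scaleVE ffunE.
have [ks|ks] := boolP (support_cond k s).
  rewrite (bigD1 s) //= eqxx mulr1 big1 ?addr0 // => l /andP[_ ls].
  by rewrite [s == l]eq_sym (negPf ls) mulr0.
have [_ ->] // := bU s; rewrite big1 // => l kl; case: (eqVneq s l) => [e|_].
  by rewrite -e (negPf ks) in kl.
by rewrite mulr0.
Qed.

Lemma canonical_coord (R : realType) n (k : n.-tuple bool) (b : Vn R n) l :
  is_canonical k b -> in_qVZqV (b l - (l == k)%:R).
Proof.
case=> _ [c [cU /ffunP/(_ l)]]; rewrite addVE oppVE ffunE => ->.
rewrite sum_ffunE; apply: in_qVZqV_sum => s _; rewrite scaleVE ffunE.
exact: in_qVZqVMr (cU s) (in_ZqV_nat _ _).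
Qed.

Theorem theorem11p2 (R : realType) (n : nat)
    (zeta : TL R n -> 'End(Vn R n)) (zetaP : is_zeta_star zeta)
    (k : n.-tuple bool) :
  exists b : Vn R n,
    unique (is_canonical k) b /\
    unique (fun w : Vn R n =>
      forall (k' : nat) (D2 : diagram n),
        (k' <= n)%N -> in_ind_basis k' D2 ->
        pairing (minus_plus R n k') (zeta (tl_basis R D2) w) =
        if (k' == nminus k) && (val D2 == label_diagram (rev_tuple k))
        then 1 else 0) b.
Proof.
have nm (s : n.-tuple bool) : (nminus s <= n)%N.
  by rewrite -[X in (_ <= X)%N](size_tuple s) count_size.
have /fin_all_exists[dg dgP] := exists_diagram zetaP.
have dgI s : in_ind_basis (nminus s) (dg s) by have [] := dgP s.
have dgL s : lab (nminus s) (dg s) = s by have [] := dgP s.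
have dgR s : realizes zeta (nminus s) (dg s) by have [] := dgP s.
pose c (s l : n.-tuple bool) := dual_vec R (nminus s) (dg s) l.
have c_diag s : c s s = 1.
  by have := dual_vec_lab (nm s) (dgI s) R; rewrite dgL.
have c_off s l : l != s -> in_qVZqV (c s l).
  by move=> ls; apply: dual_vec_qV => //; rewrite dgL.
have c_support s l : c s l != 0 -> support_cond l s.
  by move/(dual_vec_support (nm s) (dgI s)); rewrite dgL.
pose eval s (w : Vn R n) := \sum_l c s l * w l.
have evalE s w : pair_diag zeta (nminus s) (dg s) w = eval s w.
  by have [-> _] := dgR s.
have evalI (w w' : Vn R n) : (forall s, eval s w = eval s w') -> w = w'.
  exact: eval_inj c_diag c_support w w'.
have eval_theta s w : eval s (theta w) = bar (eval s w).
  by rewrite -!evalE; have [_ ->] := dgR s.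
have [b [bE bU]] := exists_dual_basis c_diag c_off c_support k.
have bE' s : eval s b = (s == k)%:R := bE s.
have dual_b k' D2 : (k' <= n)%N -> in_ind_basis k' D2 ->
    pairing (minus_plus R n k') (zeta (tl_basis R D2) b) =
    if (k' == nminus k) && (val D2 == label_diagram (rev_tuple k))
    then 1 else 0.
  move=> kn' Dk; pose s := lab k' D2; have sk : nminus s = k' by apply: nminus_lab.
  have D2E : D2 = dg s.
    have := dgI s; have := dgL s; rewrite sk => L I.
    exact: (lab_inj kn' Dk I (esym L)).
  rewrite -[LHS]/(pair_diag zeta k' D2 b) -sk {1}D2E evalE bE'.
  suff -> : (nminus s == nminus k) &&
      (val D2 == label_diagram (rev_tuple k)) = (s == k).
    by case: (s == k).
  have labE t : val (dg t) = label_diagram (rev_tuple t).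
    by have := label_diagram_lab (nm t) (dgI t); rewrite dgL.
  apply/andP/eqP => [[/eqP ek /eqP D2k]|<-]; last by rewrite eqxx D2E labE.
  have D2' : D2 = dg k by apply: val_inj; rewrite labE.
  by rewrite /s -sk ek D2' dgL.
exists b; split; split.
- apply: canonical_of_coord => //; apply: evalI => s.
  by rewrite eval_theta !bE' rmorph_nat.
- move=> b' b'c; apply: evalI => s; rewrite bE'.
  apply/esym/eqP; rewrite -subr_eq0; apply/eqP; apply: bar_fixed_qVZqV; last first.
    by rewrite rmorphB rmorph_nat /= -eval_theta; have [-> _] := b'c.
  have -> : eval s b' = c s k + \sum_l c s l * (b' l - (l == k)%:R).
    under [in RHS]eq_bigr => l _ do rewrite mulrBr.
    rewrite sumrB [X in _ - X](bigD1 k) //= eqxx mulr1.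
    rewrite [X in c s k + (_ - (_ + X))]big1 => [|l lk].
      by rewrite addr0 addrC subrK.
    by rewrite (negPf lk) mulr0.
  rewrite addrAC; apply: in_qVZqVD; last first.
    apply: in_qVZqV_sum => l _; rewrite mulrC; apply: in_qVZqVMr.
      exact: canonical_coord.
    exact: dual_vec_Z.
  have [->|sk] := eqVneq s k; first by rewrite c_diag subrr; exact: in_qVZqV0.
  by rewrite subr0; apply: c_off; rewrite eq_sym.
- exact: dual_b.
move=> w wP; apply: evalI => s; rewrite -!evalE /pair_diag.
by rewrite dual_b // wP.
Qed.
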